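(* Let $\mathcal{O}$ be a local principal ideal domain with maximal ideal $(\pi)$ and field of fractions $\mathbb{K}$. Let $(W,S)$ be a finite Coxeter system and let $\mathscr{N}=\mathscr{N}_{\mathcal{O}}(W)$ be the nilCoxeter algebra of $W$ over $\mathcal{O}$. Then there are a finite quiver $Q$ and a two-sided ideal $I$ of the path algebra $\mathcal{O}Q$ with $J_Q^n\le I\le J_Q^2$ for some $n\ge 2$ such that $\mathscr{N}\cong\mathcal{O}Q/I$ as $\mathcal{O}$-algebras and $\mathcal{O}Q/I$ is $\mathcal{O}$-free of finite rank; moreover, with $J=\mathscr{N}\cap\operatorname{Rad}(\mathbb{K}\otimes_{\mathcal{O}}\mathscr{N})$, the quotient $\mathscr{N}/J^n$ is $\mathcal{O}$-free for all $n\ge 1$.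
   Context: For an integral domain $R$, the nilCoxeter algebra $\mathscr{N}_R(W)$ is the (unital associative) $R$-algebra generated by $\{x_s:s\in S\}$ subject to $x_s^2=0$ for $s\in S$ and the braid relations $x_sx_{s'}x_s\cdots=x_{s'}x_sx_{s'}\cdots$ ($m$ factors on each side) for distinct $s,s'\in S$, where $m$ is the order of $ss'$. $\operatorname{Rad}$ denotes the Jacobson radical. $\mathcal{O}Q$ is the path algebra with $\mathcal{O}$-basis the directed paths in $Q$, and $J_Q$ is the two-sided ideal spanned by the paths of length at least one. *)

(* Defs.v *)
From HB Require Import structures.
From mathcomp Require Import all_boot all_order all_fingroup all_algebra.
From mathcomp Require Import finmap boolp classical_sets.
From mathcomp Require Import monalg.

Set Implicit Arguments.
Unset Strict Implicit.
Unset Printing Implicit Defensive.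

Import GRing.Theory.

Local Open Scope classical_set_scope.
Local Open Scope quotient_scope.
Local Open Scope ring_scope.

(* Unital associative algebras, the zero algebra included: unlike [algType],
   these are stable under quotients by arbitrary two-sided ideals. The library
   hierarchy does not allow a structure joining [pzRingType] and [lmodType] to be
   added below [lalgType], so the scaling is a field of the mixin, from which the
   module structure is derived. *)
HB.mixin Record PzRing_isPzAlgebra (R : pzRingType) A of GRing.PzRing A := {
  pz_scale : R -> A -> A;
  pz_scalerA : forall a b v, pz_scale a (pz_scale b v) = pz_scale (a * b) v;
  pz_scale1r : left_id 1 pz_scale;
  pz_scalerDr : right_distributive pz_scale +%R;
  pz_scalerDl : forall v, {morph pz_scale^~ v : a b / a + b};
  pz_scalerAl : forall a u v, pz_scale a (u * v) = pz_scale a u * v;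
  pz_scalerAr : forall a u v, pz_scale a (u * v) = u * pz_scale a v
}.

#[short(type="pzAlgType")]
HB.structure Definition PzAlgebra (R : pzRingType) :=
  {A of PzRing_isPzAlgebra R A & GRing.PzRing A}.

HB.instance Definition _ (R : pzRingType) (A : pzAlgType R) :=
  GRing.Zmodule_isLmodule.Build R (PzAlgebra.sort A)
    (@pz_scalerA R A) (@pz_scale1r R A) (@pz_scalerDr R A) (@pz_scalerDl R A).

Lemma pzalg_scalerAl (R : pzRingType) (A : pzAlgType R) (a : R) (u v : A) :
  a *: (u * v) = a *: u * v.
Proof. exact: pz_scalerAl. Qed.

Lemma pzalg_scalerAr (R : pzRingType) (A : pzAlgType R) (a : R) (u v : A) :
  a *: (u * v) = u * (a *: v).
Proof. exact: pz_scalerAr. Qed.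

Definition algebra_isomorphic (R : pzRingType) (A B : pzAlgType R) : Prop :=
  exists f : A -> B, [/\ linear f, GRing.monoid_morphism f & bijective f].

Section Bases.
Variables (R : pzRingType) (M : lmodType R).

Definition is_basis (I : eqType) (b : I -> M) : Prop :=
  (forall (s : seq I) (c : I -> R), uniq s ->
     \sum_(i <- s) c i *: b i = 0 -> forall i, i \in s -> c i = 0) /\
  (forall v : M, exists (s : seq I) (c : I -> R), v = \sum_(i <- s) c i *: b i).

Definition is_free : Prop := exists (I : eqType) (b : I -> M), is_basis b.

Definition is_free_of_finite_rank : Prop :=
  exists (n : nat) (b : 'I_n -> M), is_basis b.

End Bases.

Section Ideals.
Variable A : pzRingType.
Implicit Types (I J : set A) (x y a : A).

Definition is_left_ideal I : Prop :=
  [/\ I 0, forall x y, I x -> I y -> I (x + y) & forall a x, I x -> I (a * x)].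

Definition is_ideal I : Prop := is_left_ideal I /\ forall a x, I x -> I (x * a).

Record ideal := Ideal { ideal_set :> set A; idealP : is_ideal ideal_set }.

Definition is_maximal_left_ideal I : Prop :=
  [/\ is_left_ideal I, I <> setT &
      forall J, is_left_ideal J -> I `<=` J -> J = I \/ J = setT].

Definition jacobson_set : set A :=
  [set x | forall I, is_maximal_left_ideal I -> I x].

Lemma left_idealN I x : is_left_ideal I -> I x -> I (- x).
Proof. by move=> [_ _ IM] Ix; rewrite -mulN1r; apply: IM. Qed.

Lemma left_ideal1 I : is_left_ideal I -> I 1 -> I = setT.
Proof.
move=> [_ _ IM] I1; apply/seteqP; split => // x _.
by rewrite -[x]mulr1; apply: IM.
Qed.

Lemma jacobson_is_ideal : is_ideal jacobson_set.
Proof.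
split; first split.
- by move=> I [[I0 _ _] _ _].
- move=> x y Jx Jy I mI; case: (mI) => [[_ ID _] _ _].
  by apply: ID; [apply: Jx | apply: Jy].
- by move=> a x Jx I mI; case: (mI) => [[_ _ IM] _ _]; apply: IM; apply: Jx.
move=> r x Jx I mI; have [lI Inn Imax] := mI; have [I0 ID IM] := lI.
have [Ir|nIr] := pselect (I r); first exact: IM.
suff mL : is_maximal_left_ideal [set y | I (y * r)] by exact: (Jx _ mL).
split.
- split; first by rewrite /= mul0r.
  + by move=> y z /= Iy Iz; rewrite mulrDl; apply: ID.
  + by move=> a y /= Iy; rewrite -mulrA; apply: IM.
- move=> E; apply: nIr; rewrite -[r]mul1r.
  by have : [set y | I (y * r)] 1 by rewrite E.
move=> L lL sL; have [L0 LD LM] := lL.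
have [sL'|/existsNP[y /not_implyP[Ly nIy]]] := pselect (L `<=` [set y | I (y * r)]).
  by left; apply/seteqP; split.
right; apply: left_ideal1 => //.
pose K : set A := [set z | exists m a, I m /\ z = m + a * (y * r)].
have lK : is_left_ideal K.
  split; first by exists 0, 0; rewrite mul0r addr0.
  - move=> _ _ [m [a [Im ->]]] [m' [a' [Im' ->]]]; exists (m + m'), (a + a').
    by split; [exact: ID | rewrite mulrDl addrACA].
  - move=> b _ [m [a [Im ->]]]; exists (b * m), (b * a).
    by split; [exact: IM | rewrite mulrDr !mulrA].
have IK : I `<=` K by move=> m Im; exists m, 0; rewrite mul0r addr0.
case: (Imax K lK IK) => KE.
  by exfalso; apply: nIy; rewrite -KE; exists 0, 1; rewrite mul1r add0r.
have [m [a [Im rE]]] : K r by rewrite KE.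
rewrite -(subrK (a * y) 1); apply: LD; last exact: LM.
by apply: sL; rewrite /= mulrBl mul1r -mulrA {1}rE addrK.
Qed.

Definition jacobson : ideal := Ideal jacobson_is_ideal.

Definition ideal_gen_set (X : set A) : set A :=
  [set x | forall I, is_ideal I -> X `<=` I -> I x].

Lemma ideal_gen_is_ideal (X : set A) : is_ideal (ideal_gen_set X).
Proof.
split; first split.
- by move=> I [[]].
- move=> x y Jx Jy I iI sI; case: (iI) => [[_ ID _] _].
  by apply: ID; [apply: Jx | apply: Jy].
- by move=> a x Jx I iI sI; case: (iI) => [[_ _ IM] _]; apply: IM; apply: Jx.
by move=> a x Jx I iI sI; case: (iI) => [_ IM]; apply: IM; apply: Jx.
Qed.

Definition ideal_gen (X : set A) : ideal := Ideal (ideal_gen_is_ideal X).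

Definition ideal_mul_set I J : set A :=
  [set x | exists s : seq (A * A),
     (forall u, u \in s -> I u.1 /\ J u.2) /\ x = \sum_(u <- s) u.1 * u.2].

Lemma ideal_mul_is_ideal (I J : ideal) : is_ideal (ideal_mul_set I J).
Proof.
have [[_ _ IM] _] := idealP I; have [_ JM] := idealP J.
split; first split.
- by exists [::]; rewrite big_nil.
- move=> _ _ [s [sP ->]] [t [tP ->]]; exists (s ++ t); rewrite big_cat.
  by split=> // u; rewrite mem_cat => /orP[/sP|/tP].
- move=> a _ [s [sP ->]]; exists [seq (a * u.1, u.2) | u <- s]; split.
    by move=> _ /mapP[u /sP[Iu Ju] ->]; split=> //=; apply: IM.
  by rewrite big_map mulr_sumr; apply: eq_bigr => u _; rewrite /= mulrA.
move=> a _ [s [sP ->]]; exists [seq (u.1, u.2 * a) | u <- s]; split.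
  by move=> _ /mapP[u /sP[Iu Ju] ->]; split=> //=; apply: JM.
by rewrite big_map mulr_suml; apply: eq_bigr => u _; rewrite /= mulrA.
Qed.

Definition ideal_mul (I J : ideal) : ideal := Ideal (ideal_mul_is_ideal I J).

Lemma ideal_full_is_ideal : is_ideal [set: A].
Proof. by []. Qed.

Definition ideal_exp (I : ideal) (n : nat) : ideal :=
  iter n (ideal_mul I) (Ideal ideal_full_is_ideal).

End Ideals.

Lemma ideal_preimage_is_ideal (A B : pzRingType) (f : {rmorphism A -> B})
  (I : ideal B) : is_ideal (f @^-1` I).
Proof.
have [[I0 ID IM] IMr] := idealP I; split; first split=> /=.
- by rewrite rmorph0.
- by move=> x y Ix Iy; rewrite /= rmorphD; apply: ID.
- by move=> a x Ix; rewrite /= rmorphM; apply: IM.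
- by move=> a x Ix; rewrite /= rmorphM; apply: IMr.
Qed.

Definition ideal_preimage (A B : pzRingType) (f : {rmorphism A -> B})
  (I : ideal B) : ideal A := Ideal (ideal_preimage_is_ideal f I).

Definition principal_ideal (R : comPzRingType) (a : R) : set R :=
  [set x | exists r, x = r * a].

Definition is_pid (R : idomainType) : Prop :=
  forall I : set R, is_ideal I -> exists a, I = principal_ideal a.

(* Over a commutative ring left ideals are ideals. *)
Definition is_local_with (R : comPzRingType) (m : set R) : Prop :=
  is_maximal_left_ideal m /\ forall I, is_maximal_left_ideal I -> I = m.

(* The library's {quot _} of a Z-module by a boolean subgroup, with the ring and
   module structures available when the subgroup is a two-sided ideal. *)
Section QuotientAlgebra.
Variables (R : pzRingType) (A : pzAlgType R) (I : ideal A).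

Definition ideal_pred : {pred A} := fun x => `[< ideal_set I x >].

Lemma ideal_predE x : (x \in ideal_pred) = `[< ideal_set I x >].
Proof. by []. Qed.

Lemma ideal_pred_zmod_closed : zmod_closed ideal_pred.
Proof.
have [lI _] := idealP I; have [I0 ID _] := lI.
split; first by rewrite ideal_predE; apply/asboolP.
move=> x y; rewrite !ideal_predE => /asboolP Ix /asboolP Iy.
by apply/asboolP; apply: ID => //; apply: left_idealN.
Qed.

HB.instance Definition _ := GRing.isZmodClosed.Build A ideal_pred
  ideal_pred_zmod_closed.

Definition quotient_alg : Type := Quotient.quot ideal_pred.
HB.instance Definition _ := GRing.Zmodule.on quotient_alg.
HB.instance Definition _ := EqQuotient.on quotient_alg.

Definition proj_quot (x : A) : quotient_alg := \pi_quotient_alg x.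

Definition repr_quot (x : quotient_alg) : A := generic_quotient.repr x.

Lemma repr_quotK : cancel repr_quot proj_quot.
Proof. exact: reprK. Qed.

Lemma proj_quot_eq (x y : A) : proj_quot x = proj_quot y <-> ideal_set I (x - y).
Proof.
split.
  by move=> /eqP; rewrite /proj_quot -Quotient.idealrBE ideal_predE => /asboolP.
move=> Ixy; apply/eqP; rewrite /proj_quot -Quotient.idealrBE ideal_predE.
exact/asboolP.
Qed.

Lemma proj_quotD : {morph proj_quot : x y / x + y}.
Proof. by move=> x y; rewrite /proj_quot !piE. Qed.

Definition one_quot : quotient_alg := proj_quot 1.
Definition mul_quot (x y : quotient_alg) : quotient_alg :=
  proj_quot (repr_quot x * repr_quot y).
Definition scale_quot (a : R) (x : quotient_alg) : quotient_alg :=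
  proj_quot (a *: repr_quot x).

Lemma repr_proj_quot (x : A) : ideal_set I (repr_quot (proj_quot x) - x).
Proof. by apply/proj_quot_eq; rewrite repr_quotK. Qed.

Lemma proj_quotM (x y : A) :
  mul_quot (proj_quot x) (proj_quot y) = proj_quot (x * y).
Proof.
have [[_ ID IM] IMr] := idealP I; apply/proj_quot_eq.
set x' := repr_quot _; set y' := repr_quot _.
have -> : x' * y' - x * y = x' * (y' - y) + (x' - x) * y.
  by rewrite mulrBr mulrBl addrA subrK.
by apply: ID; [apply: IM; exact: repr_proj_quot | apply: IMr; exact: repr_proj_quot].
Qed.

Lemma proj_quotZ a (x : A) : scale_quot a (proj_quot x) = proj_quot (a *: x).
Proof.
have [[_ _ IM] _] := idealP I; apply/proj_quot_eq.
by rewrite -scalerBr -[_ - _]mul1r pzalg_scalerAl; apply: IM; exact: repr_proj_quot.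
Qed.

Lemma mul_quotA : associative mul_quot.
Proof.
move=> x y z; rewrite -[x]repr_quotK -[y]repr_quotK -[z]repr_quotK.
by rewrite !proj_quotM mulrA.
Qed.

Lemma mul1_quot : left_id one_quot mul_quot.
Proof. by move=> x; rewrite -[x]repr_quotK proj_quotM mul1r. Qed.

Lemma mul_quot1 : right_id one_quot mul_quot.
Proof. by move=> x; rewrite -[x]repr_quotK proj_quotM mulr1. Qed.

Lemma mul_quotDl : left_distributive mul_quot +%R.
Proof.
move=> x y z; rewrite -[x]repr_quotK -[y]repr_quotK -[z]repr_quotK.
by rewrite -proj_quotD !proj_quotM mulrDl proj_quotD.
Qed.

Lemma mul_quotDr : right_distributive mul_quot +%R.
Proof.
move=> x y z; rewrite -[x]repr_quotK -[y]repr_quotK -[z]repr_quotK.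
by rewrite -proj_quotD !proj_quotM mulrDr proj_quotD.
Qed.

HB.instance Definition _ := GRing.Zmodule_isPzRing.Build quotient_alg
  mul_quotA mul1_quot mul_quot1 mul_quotDl mul_quotDr.

Lemma scale_quotA a b x : scale_quot a (scale_quot b x) = scale_quot (a * b) x.
Proof. by rewrite -[x]repr_quotK !proj_quotZ scalerA. Qed.

Lemma scale1_quot : left_id 1 scale_quot.
Proof. by move=> x; rewrite -[x]repr_quotK proj_quotZ scale1r. Qed.

Lemma scale_quotDr : right_distributive scale_quot +%R.
Proof.
move=> a x y; rewrite -[x]repr_quotK -[y]repr_quotK.
by rewrite -proj_quotD !proj_quotZ scalerDr proj_quotD.
Qed.

Lemma scale_quotDl x : {morph scale_quot^~ x : a b / a + b}.
Proof.
by move=> a b; rewrite -[x]repr_quotK !proj_quotZ scalerDl proj_quotD.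
Qed.

HB.instance Definition _ := GRing.Zmodule_isLmodule.Build R quotient_alg
  scale_quotA scale1_quot scale_quotDr scale_quotDl.

Lemma quot_scalerAl (a : R) (u v : quotient_alg) : a *: (u * v) = (a *: u) * v.
Proof.
rewrite -[u]repr_quotK -[v]repr_quotK /GRing.scale /GRing.mul /=.
by rewrite proj_quotM !proj_quotZ proj_quotM pzalg_scalerAl.
Qed.

Lemma quot_scalerAr (a : R) (u v : quotient_alg) : a *: (u * v) = u * (a *: v).
Proof.
rewrite -[u]repr_quotK -[v]repr_quotK /GRing.scale /GRing.mul /=.
by rewrite proj_quotM !proj_quotZ proj_quotM pzalg_scalerAr.
Qed.

HB.instance Definition _ := PzRing_isPzAlgebra.Build R quotient_alg
  scale_quotA scale1_quot scale_quotDr scale_quotDl quot_scalerAl quot_scalerAr.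

Lemma proj_quot_is_zmod_morphism : zmod_morphism proj_quot.
Proof.
move=> x y; apply: (addIr (proj_quot y)).
by rewrite -proj_quotD !subrK.
Qed.

HB.instance Definition _ :=
  GRing.isZmodMorphism.Build A quotient_alg proj_quot proj_quot_is_zmod_morphism.

Lemma proj_quot_is_monoid_morphism : GRing.monoid_morphism proj_quot.
Proof. by split=> // x y; rewrite -proj_quotM. Qed.

HB.instance Definition _ :=
  GRing.isMonoidMorphism.Build A quotient_alg proj_quot
    proj_quot_is_monoid_morphism.

Lemma proj_quot_is_scalable : scalable proj_quot.
Proof. by move=> a x; rewrite -proj_quotZ. Qed.

HB.instance Definition _ :=
  GRing.isScalable.Build R A quotient_alg *:%R proj_quot proj_quot_is_scalable.

End QuotientAlgebra.

(* The free algebra on X is the library's monoid algebra of the free monoid. *)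
Section FreeAlgebra.
Variables (R : comNzRingType) (X : choiceType).

Definition free_alg : Type := {malg R[{fmonom X}]}.
HB.instance Definition _ := GRing.Lalgebra.on free_alg.

Lemma free_scalerAr (a : R) (u v : free_alg) : a *: (u * v) = u * (a *: v).
Proof.
apply/malgP => k; rewrite mcoeffZ (mcoeffMlw k (fsubset_refl _) (msuppZ_le a v)).
rewrite mcoeffMl mulr_sumr; apply: eq_bigr => k1 _.
rewrite mulr_sumr; apply: eq_bigr => k2 _.
by rewrite mcoeffZ mulrnAr mulrCA.
Qed.

HB.instance Definition _ := PzRing_isPzAlgebra.Build R free_alg
  (@scalerA R free_alg) (@scale1r R free_alg) (@scalerDr R free_alg)
  (fun v a b => @scalerDl R free_alg v a b)
  (@scalerAl R free_alg) free_scalerAr.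

Definition free_gen (x : X) : free_alg := << fmu x >>.

Definition presented_alg (rel : set free_alg) : Type :=
  quotient_alg (ideal_gen rel).
HB.instance Definition _ (rel : set free_alg) :=
  PzAlgebra.on (presented_alg rel).

Definition presented_gen (rel : set free_alg) (x : X) : presented_alg rel :=
  proj_quot (ideal_gen rel) (free_gen x).

Lemma presented_rel (rel : set free_alg) (u : free_alg) :
  rel u -> proj_quot (ideal_gen rel) u = 0.
Proof.
move=> ru; rewrite -(raddf0 (proj_quot _)); apply/proj_quot_eq.
by rewrite subr0 => I _; apply.
Qed.

End FreeAlgebra.

(* K \otimes_R A, for K an R-algebra through f, is the R-algebra generated by the
   pure tensors k \otimes n, subject to bilinearity over R and to
   (k \otimes n) (k' \otimes n') = k k' \otimes n n' and 1 \otimes 1 = 1. *)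
Section Tensor.
Variables (R K : comNzRingType) (f : {rmorphism R -> K}) (A : pzAlgType R).

Definition pure (k : K) (n : A) : free_alg R (K * A)%type := free_gen R (k, n).

Inductive tensor_rel : set (free_alg R (K * A)%type) :=
| tensor_addl k k' n : tensor_rel (pure (k + k') n - (pure k n + pure k' n))
| tensor_addr k n n' : tensor_rel (pure k (n + n') - (pure k n + pure k n'))
| tensor_scalel a k n : tensor_rel (pure (f a * k) n - a *: pure k n)
| tensor_scaler a k n : tensor_rel (pure k (a *: n) - a *: pure k n)
| tensor_one : tensor_rel (pure 1 1 - 1)
| tensor_mul k k' n n' :
    tensor_rel (pure (k * k') (n * n') - pure k n * pure k' n').

Definition tensor_alg : Type := presented_alg tensor_rel.
HB.instance Definition _ := PzAlgebra.on tensor_alg.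

Definition tensor (k : K) (n : A) : tensor_alg := presented_gen tensor_rel (k, n).

Lemma tensor_relP u v : tensor_rel (u - v) ->
  proj_quot (ideal_gen tensor_rel) u = proj_quot (ideal_gen tensor_rel) v.
Proof. by move=> /presented_rel; rewrite raddfB /= => /subr0_eq. Qed.

Definition tensor_incl (n : A) : tensor_alg := tensor 1 n.

Lemma tensor_incl_is_zmod_morphism : zmod_morphism tensor_incl.
Proof.
move=> x y; apply: (addIr (tensor_incl y)); rewrite subrK.
have := tensor_relP (tensor_addr 1 (x - y) y).
by rewrite [x - y + y]subrK raddfD => /esym.
Qed.

HB.instance Definition _ :=
  GRing.isZmodMorphism.Build A tensor_alg tensor_incl tensor_incl_is_zmod_morphism.

Lemma tensor_incl_is_monoid_morphism : GRing.monoid_morphism tensor_incl.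
Proof.
split; first by have := tensor_relP tensor_one; rewrite rmorph1.
by move=> x y; have := tensor_relP (tensor_mul 1 1 x y); rewrite mul1r rmorphM.
Qed.

HB.instance Definition _ :=
  GRing.isMonoidMorphism.Build A tensor_alg tensor_incl
    tensor_incl_is_monoid_morphism.

End Tensor.

Record quiver := Quiver {
  vertex : finType;
  arrow : finType;
  source : arrow -> vertex;
  target : arrow -> vertex
}.

Section Paths.
Variable Q : quiver.
Implicit Types (v : vertex Q) (s : seq (arrow Q)).

Fixpoint is_path_from v s : bool :=
  if s is a :: s' then (source a == v) && is_path_from (target a) s' else true.

(* A directed path: its starting vertex and its arrows in the order of travel;
   the trivial path at v is (v, [::]). *)
Record qpath : Type := QPath {
  path_val : vertex Q * seq (arrow Q);
  _ : is_path_from path_val.1 path_val.2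
}.
HB.instance Definition _ := [isSub for path_val].
HB.instance Definition _ := [Choice of qpath by <:].

Definition path_source (p : qpath) : vertex Q := (val p).1.
Definition path_arrows (p : qpath) : seq (arrow Q) := (val p).2.
Definition path_target (p : qpath) : vertex Q :=
  last (path_source p) (map (@target Q) (path_arrows p)).
Definition path_length (p : qpath) : nat := size (path_arrows p).

Definition trivial_path v : qpath := @QPath (v, [::]) isT.

(* p followed by q, when defined *)
Definition path_cat (p q : qpath) : option qpath :=
  if path_target p == path_source q then
    (insub (path_source p, path_arrows p ++ path_arrows q) : option qpath)
  else None.

Lemma is_path_from_cat v s t :
  is_path_from v (s ++ t) =
  is_path_from v s && is_path_from (last v (map (@target Q) s)) t.
Proof. by elim: s v => //= a s IHs v; rewrite IHs andbA. Qed.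

Lemma path_catP (p q : qpath) : path_target p = path_source q ->
  exists2 r, path_cat p q = Some r
           & path_source r = path_source p
             /\ path_arrows r = path_arrows p ++ path_arrows q.
Proof.
move=> pq; rewrite /path_cat pq eqxx.
case: insubP => [r _ rE|]; first by exists r; rewrite // /path_source /path_arrows rE.
rewrite /= is_path_from_cat (valP p) /=.
by rewrite -[last _ _]/(path_target p) pq (valP q).
Qed.

Lemma path_eq (p q : qpath) : path_source p = path_source q ->
  path_arrows p = path_arrows q -> p = q.
Proof.
move=> h1 h2; apply: val_inj; rewrite [LHS]surjective_pairing [RHS]surjective_pairing.
by congr (_, _).
Qed.

Lemma path_cat_target (p q r : qpath) : path_cat p q = Some r ->
  path_target r = path_target q.
Proof.
rewrite {1}/path_cat; case: eqP => // pq.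
have [r' + [rs ra]] := path_catP pq; rewrite {1}/path_cat pq eqxx => -> [<-].
rewrite /path_target ra rs map_cat last_cat.
by rewrite -[last (path_source p) _]/(path_target p) pq.
Qed.

Lemma path_catA (p q r : qpath) :
  obind (path_cat p) (path_cat q r) = obind (path_cat^~ r) (path_cat p q).
Proof.
have [pq|npq] := eqVneq (path_target p) (path_source q); last first.
  rewrite [in RHS]/path_cat (negbTE npq) /=.
  have [qr|nqr] := eqVneq (path_target q) (path_source r); last first.
    by rewrite /path_cat (negbTE nqr).
  have [u -> [us _]] /= := path_catP qr.
  by rewrite /path_cat us (negbTE npq).
have [w wE [ws wa]] := path_catP pq; rewrite wE /=.
have wt := path_cat_target wE.
have [qr|nqr] := eqVneq (path_target q) (path_source r); last first.
  by rewrite /path_cat wt (negbTE nqr).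
have [u -> [us ua]] /= := path_catP qr.
have [|x -> [xs xa]] := @path_catP p u; first by rewrite us.
have [|y -> [ys ya]] := @path_catP w r; first by rewrite wt.
by congr Some; apply: path_eq; rewrite ?xs ?ys // xa ya ua wa catA.
Qed.

Lemma path_cat_trivl v (p : qpath) :
  path_cat (trivial_path v) p = if v == path_source p then Some p else None.
Proof.
have [vp|nvp] := eqVneq v (path_source p); last by rewrite /path_cat (negbTE nvp).
have [|r -> [rs ra]] := @path_catP (trivial_path v) p; first by [].
by congr Some; apply: path_eq; rewrite ?rs.
Qed.

Lemma path_cat_trivr v (p : qpath) :
  path_cat p (trivial_path v) = if path_target p == v then Some p else None.
Proof.
have [vp|nvp] := eqVneq (path_target p) v; last by rewrite /path_cat (negbTE nvp).
have [|r -> [rs ra]] := @path_catP p (trivial_path v); first by [].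
by congr Some; apply: path_eq; rewrite ?rs // ra cats0.
Qed.

Lemma path_cat_length (p q r : qpath) : path_cat p q = Some r ->
  path_length r = (path_length p + path_length q)%N.
Proof.
rewrite {1}/path_cat; case: eqP => // pq.
have [r' + [_ ra]] := path_catP pq; rewrite {1}/path_cat pq eqxx => -> [<-].
by rewrite /path_length ra size_cat.
Qed.

End Paths.

Section PathAlgebra.
Variables (R : comNzRingType) (Q : quiver).

Definition path_alg : Type := {malg R[qpath Q]}.
HB.instance Definition _ := GRing.Lmodule.on path_alg.

Implicit Types (f g h : path_alg) (p q r : qpath Q) (c : R).

Definition path_basis p : path_alg := << p >>.

Definition path_mul_basis p q : path_alg :=
  if path_cat p q is Some r then path_basis r else 0.

(* Locked: unifying with the unfolded sum can diverge. *)
Fact path_mul_key : unit. Proof. exact: tt. Qed.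

Definition path_mul f g : path_alg := locked_with path_mul_key
  (\sum_(p <- msupp f) \sum_(q <- msupp g)
    (f@_p * g@_q) *: path_mul_basis p q).

Definition path_one : path_alg := \sum_(v : vertex Q) path_basis (trivial_path v).

Lemma path_mulw (d1 d2 : {fset qpath Q}) f g :
  (msupp f `<=` d1)%fset -> (msupp g `<=` d2)%fset ->
  path_mul f g =
    \sum_(p <- d1) \sum_(q <- d2) (f@_p * g@_q) *: path_mul_basis p q.
Proof.
move=> le_d1 le_d2; rewrite /path_mul locked_withE (big_fset_incl _ le_d1) /=.
  apply/eq_bigr=> p _; apply/big_fset_incl => // q _ /mcoeff_outdom ->.
  by rewrite mulr0 scale0r.
move=> p _ /mcoeff_outdom fp; rewrite big1 // => q _.
by rewrite fp mul0r scale0r.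
Qed.

Lemma path_mulDl : left_distributive path_mul +%R.
Proof.
move=> f g h; pose d := (msupp f `|` msupp g)%fset; pose e := msupp h.
have sf : (msupp f `<=` d)%fset by apply: fsubsetUl.
have sg : (msupp g `<=` d)%fset by apply: fsubsetUr.
have sfg : (msupp (f + g) `<=` d)%fset by apply: msuppD_le.
have sh : (msupp h `<=` e)%fset by apply: fsubset_refl.
rewrite (path_mulw sf sh) (path_mulw sg sh) (path_mulw sfg sh) -big_split /=.
apply: eq_bigr => p _; rewrite -big_split /=; apply: eq_bigr => q _.
by rewrite mcoeffD mulrDl scalerDl.
Qed.

Lemma path_mulDr : right_distributive path_mul +%R.
Proof.
move=> h f g; pose d := (msupp f `|` msupp g)%fset; pose e := msupp h.
have sf : (msupp f `<=` d)%fset by apply: fsubsetUl.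
have sg : (msupp g `<=` d)%fset by apply: fsubsetUr.
have sfg : (msupp (f + g) `<=` d)%fset by apply: msuppD_le.
have sh : (msupp h `<=` e)%fset by apply: fsubset_refl.
rewrite (path_mulw sh sf) (path_mulw sh sg) (path_mulw sh sfg) -big_split /=.
apply: eq_bigr => p _; rewrite -big_split /=; apply: eq_bigr => q _.
by rewrite mcoeffD mulrDr scalerDl.
Qed.

Lemma path_mulZl c f g : c *: path_mul f g = path_mul (c *: f) g.
Proof.
rewrite (path_mulw (msuppZ_le c f) (fsubset_refl _)).
rewrite /path_mul locked_withE scaler_sumr; apply: eq_bigr => p _; rewrite scaler_sumr; apply: eq_bigr => q _.
by rewrite scalerA mcoeffZ mulrA.
Qed.

Lemma path_mulZr c f g : c *: path_mul f g = path_mul f (c *: g).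
Proof.
rewrite (path_mulw (fsubset_refl _) (msuppZ_le c g)).
rewrite /path_mul locked_withE scaler_sumr; apply: eq_bigr => p _; rewrite scaler_sumr; apply: eq_bigr => q _.
by rewrite scalerA mcoeffZ mulrCA.
Qed.

Lemma path_mul0l g : path_mul 0 g = 0.
Proof. by rewrite /path_mul locked_withE msupp0 big_seq_fset0. Qed.

Lemma path_mul0r f : path_mul f 0 = 0.
Proof. by have := path_mulZr 0 f 0; rewrite !scale0r => <-. Qed.

Lemma path_mulE p q : path_mul (path_basis p) (path_basis q) = path_mul_basis p q.
Proof.
rewrite (path_mulw (msuppU_le (k := p)) (msuppU_le (k := q))) !big_seq_fset1.
by rewrite !mcoeffUU mulr1 scale1r.
Qed.

Lemma path_basis_ind (P : path_alg -> Prop) :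
  P 0 -> (forall f g, P f -> P g -> P (f + g)) ->
  (forall c p, P (c *: path_basis p)) -> forall f, P f.
Proof.
move=> P0 PD PZ f; rewrite [f]monalgE; apply: big_ind => // p _.
suff -> : << f@_p *g p >> = f@_p *: path_basis p :> path_alg by apply: PZ.
by move: (f@_p) => c; apply/malgP => q; rewrite mcoeffZ !mcoeffU mulrnAr mulr1.
Qed.

Lemma path_mul_suml (I : Type) (s : seq I) (F : I -> path_alg) g :
  path_mul (\sum_(i <- s) F i) g = \sum_(i <- s) path_mul (F i) g.
Proof.
by apply: (big_morph (path_mul^~ g)) => [f h|]; rewrite ?path_mulDl ?path_mul0l.
Qed.

Lemma path_mul_sumr (I : Type) (s : seq I) (F : I -> path_alg) f :
  path_mul f (\sum_(i <- s) F i) = \sum_(i <- s) path_mul f (F i).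
Proof.
by apply: (big_morph (path_mul f)) => [g h|]; rewrite ?path_mulDr ?path_mul0r.
Qed.

Lemma path_mulA : associative path_mul.
Proof.
have E p q r : path_mul (path_basis p) (path_mul_basis q r) =
               path_mul (path_mul_basis p q) (path_basis r).
  have := path_catA p q r; rewrite /path_mul_basis.
  case: (path_cat q r) => [u|]; case: (path_cat p q) => [w|] /= E.
  - by rewrite (path_mulE p u) (path_mulE w r) /path_mul_basis E.
  - by rewrite path_mul0l path_mulE /path_mul_basis E.
  - by rewrite path_mul0r path_mulE /path_mul_basis -E.
  - by rewrite path_mul0l path_mul0r.
move: path_mulE path_mulDl path_mulDr path_mulZl path_mulZr path_mul0l path_mul0r E.
move: path_mul path_basis path_mul_basis path_basis_ind => m b mb ind.
move=> mE mDl mDr mZl mZr m0l m0r E f g h.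
elim/ind: f => [|f f' IH IH'|c p]; first by rewrite !m0l.
  by rewrite !mDl IH IH'.
rewrite -(mZl c (b p) (m g h)) -(mZl c (b p) g) -(mZl c (m (b p) g) h).
congr (_ *: _).
elim/ind: g => [|g g' IH IH'|d q]; first by rewrite m0l !m0r m0l.
  by rewrite mDl !mDr mDl IH IH'.
rewrite -(mZl d (b q) h) -(mZr d (b p) (m (b q) h)) -(mZr d (b p) (b q)).
rewrite -(mZl d (m (b p) (b q)) h); congr (_ *: _).
elim/ind: h => [|h h' IH IH'|a r]; first by rewrite !m0r.
  by rewrite !mDr IH IH'.
rewrite -(mZr a (b q) (b r)) -(mZr a (b p) (m (b q) (b r))).
by rewrite -(mZr a (m (b p) (b q)) (b r)) (mE q r) (mE p q) E.
Qed.

Lemma path_mul1l : left_id path_one path_mul.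
Proof.
have E p : path_mul path_one (path_basis p) = path_basis p.
  rewrite /path_one path_mul_suml (bigD1 (path_source p)) //= path_mulE.
  rewrite /path_mul_basis path_cat_trivl eqxx big1 ?addr0 // => v /negbTE nv.
  by rewrite path_mulE /path_mul_basis path_cat_trivl nv.
move: path_mulDr path_mulZr path_mul0r E.
move: path_mul path_basis path_one path_basis_ind => m b e ind mDr mZr m0r E f.
elim/ind: f => [|f f' IH IH'|c p]; first exact: m0r.
  by rewrite mDr IH IH'.
by rewrite -mZr E.
Qed.

Lemma path_mul1r : right_id path_one path_mul.
Proof.
have E p : path_mul (path_basis p) path_one = path_basis p.
  rewrite /path_one path_mul_sumr.
  rewrite (bigD1 (path_target p)) //=.
  rewrite big1 ?addr0.
    by rewrite path_mulE /path_mul_basis path_cat_trivr eqxx.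
  move=> v /negbTE nv.
  by rewrite path_mulE /path_mul_basis path_cat_trivr eq_sym nv.
move: path_mulDl path_mulZl path_mul0l E.
move: path_mul path_basis path_one path_basis_ind => m b e ind mDl mZl m0l E f.
elim/ind: f => [|f f' IH IH'|c p]; first exact: m0l.
  by rewrite mDl IH IH'.
by rewrite -mZl E.
Qed.

HB.instance Definition _ := GRing.Zmodule_isPzRing.Build path_alg
  path_mulA path_mul1l path_mul1r path_mulDl path_mulDr.

HB.instance Definition _ := PzRing_isPzAlgebra.Build R path_alg
  (@scalerA R path_alg) (@scale1r R path_alg) (@scalerDr R path_alg)
  (fun v a b => @scalerDl R path_alg v a b) path_mulZl path_mulZr.

(* J_Q, the span of the paths of length at least one *)
Definition arrow_ideal_set : set path_alg :=
  [set f | forall p, p \in msupp f -> (0 < path_length p)%N].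

Lemma arrow_ideal_is_ideal : is_ideal arrow_ideal_set.
Proof.
have E f : arrow_ideal_set f <-> forall p, path_length p = 0%N -> f@_p = 0.
  split=> [fJ p p0|fJ p].
    by apply/eqP; rewrite mcoeff_eq0; apply/negP => /fJ; rewrite p0.
  by rewrite -mcoeff_neq0 lt0n; apply: contra_neq => /fJ.
have M f g : arrow_ideal_set f \/ arrow_ideal_set g -> arrow_ideal_set (f * g).
  move=> fg; apply/E => r r0; rewrite [f * g]locked_withE raddf_sum big1_seq // => p /andP[_ pf].
  rewrite raddf_sum big1_seq // => q /andP[_ qg] /=; rewrite mcoeffZ /path_mul_basis.
  case ucat: path_cat => [u|]; last by rewrite mcoeff0 mulr0.
  rewrite mcoeffU; case: eqP => [ur|_]; last by rewrite mulr0.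
  move/path_cat_length: ucat; rewrite ur r0 => /esym/eqP; rewrite addn_eq0.
  by case/andP => /eqP p0 /eqP q0; case: fg => [/(_ p pf)|/(_ q qg)]; rewrite ?p0 ?q0.
split; first split.
- by apply/E => p _; rewrite mcoeff0.
- by move=> f g /E Jf /E Jg; apply/E => p p0; rewrite mcoeffD Jf ?Jg ?addr0.
- by move=> f g Jg; apply: M; right.
- by move=> f g Jg; apply: M; left.
Qed.

Definition arrow_ideal : ideal path_alg := Ideal arrow_ideal_is_ideal.

End PathAlgebra.

Section Coxeter.
Variables (W : finGroupType) (S : {set W}).

Definition simple : Type := {s : W | s \in S}.
HB.instance Definition _ := Finite.on simple.

Definition coxeter_order (s t : simple) : nat := #[(val s * val t)%g]%g.

(* S consists of involutions, generates W, and together with the relations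
   (s t) ^ m(s, t) = 1, m(s, t) the order of s t, forms a presentation of W. *)
Definition is_coxeter_system : Prop :=
  [/\ forall s, s \in S -> #[s]%g = 2,
      <<S>>%g = [set: W]%SET &
      forall (G : groupType) (f : simple -> G),
        (forall s t : simple, ((f s * f t) ^+ coxeter_order s t = 1)%g) ->
        exists2 F : W -> G, {morph F : x y / (x * y)%g}
          & forall s : simple, F (val s) = f s].

End Coxeter.

Section NilCoxeter.
Variables (R : idomainType) (W : finGroupType) (S : {set W}).

Local Notation x := (@free_gen R (simple S)).

(* the product x_s x_t x_s ... with m factors *)
Definition braid_word (s t : simple S) (m : nat) : free_alg R (simple S) :=
  \prod_(i < m) (if odd i then x t else x s).

Inductive nilcoxeter_rel : set (free_alg R (simple S)) :=
| nilcoxeter_square s : nilcoxeter_rel (x s ^+ 2)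
| nilcoxeter_braid s t : s != t ->
    nilcoxeter_rel (braid_word s t (coxeter_order s t) -
                    braid_word t s (coxeter_order s t)).

Definition nilcoxeter : Type := presented_alg nilcoxeter_rel.
HB.instance Definition _ := PzAlgebra.on nilcoxeter.

End NilCoxeter.

(* Main.v *)
From HB Require Import structures.
Require Import Defs.
From mathcomp Require Import all_boot all_order all_fingroup all_algebra.
From mathcomp Require Import cyclic finmap boolp classical_sets monalg.

(* Write x_c for the product of the generators along a word c. Letting W act on
   W x {+,-} attaches to every w its set of left inversions; this gives the
   exchange property, and hence Matsumoto's theorem: x_c depends only on the
   product of c when c is reduced, and x_c = 0 otherwise. So the elements T_w
   span N. They are independent because the linear form on the free algebra that
   sums the coefficients of the reduced words of w vanishes on the relations: the
   two sides of a braid relation have the same length and the same product in W,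
   and no word containing s s is reduced.

   For the quiver take one vertex with one loop per generator, and for I the
   kernel of the evaluation of paths. Words longer than every length evaluate to
   0, while paths of length at most one go to distinct basis elements.

   The coefficient of T_1 is an augmentation of N with nilpotent kernel. It
   extends to K (x) N -> K, whose kernel is a maximal left ideal, so J is the
   augmentation ideal; J^n is then spanned by the T_w with l(w) >= n. *)

Set Implicit Arguments.
Unset Strict Implicit.
Unset Printing Implicit Defensive.

Import GRing.Theory.

(** * Coxeter words *)

Section CoxeterWords.
Local Open Scope group_scope.

Variables (W : finGroupType) (S : {set W}).
Local Notation word := (seq (simple S)).

Definition wprod (c : word) : W := \prod_(s <- c) val s.

Lemma wprod_nil : wprod [::] = 1.
Proof. exact: big_nil. Qed.

Lemma wprod_cons s c : wprod (s :: c) = val s * wprod c.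
Proof. exact: big_cons. Qed.

Lemma wprod_cat c d : wprod (c ++ d) = wprod c * wprod d.
Proof. exact: big_cat. Qed.

Fixpoint alt_word (k : nat) (s t : simple S) : word :=
  if k is k'.+1 then s :: alt_word k' t s else [::].

Lemma size_alt_word k s t : size (alt_word k s t) = k.
Proof. by elim: k s t => //= k IHk s t; rewrite IHk. Qed.

Lemma coxeter_orderC (s t : simple S) : coxeter_order s t = coxeter_order t s.
Proof.
rewrite /coxeter_order -(orderJ (val s * val t) (val s)) conjgE.
by rewrite !mulgA mulVg mul1g.
Qed.

Hypothesis WS : is_coxeter_system S.

Lemma simple_sqr (s : simple S) : val s * val s = 1.
Proof.
have [ordS _ _] := WS.
by have := expg_order (val s); rewrite ordS ?(valP s) // expgS expg1.
Qed.

Lemma simpleV (s : simple S) : (val s)^-1 = val s.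
Proof. by apply/eqP; rewrite eq_invg_mul simple_sqr. Qed.

Lemma simpleK (s : simple S) w : val s * (val s * w) = w.
Proof. by rewrite mulgA simple_sqr mul1g. Qed.

Lemma exists_word w : exists c : word, wprod c = w.
Proof.
have [_ genS _] := WS.
have /gen_prodgP[n [c cS ->]] : w \in <<S>> by rewrite genS inE.
elim: n c cS => [|n IHn] c cS.
  by exists [::]; rewrite wprod_nil big_ord0.
have [d dE] := IHn (fun i => c (lift ord0 i)) (fun i => cS _).
exists (Sub (c ord0) (cS ord0) :: d).
by rewrite wprod_cons dE big_ord_recl SubK.
Qed.

(** * Signed reflection action and inversion sets *)

Lemma simple_mul_expC (s t : simple S) k :
  val s * (val t * val s) ^+ k = (val s * val t) ^+ k * val s.
Proof.
elim: k => [|k IHk]; first by rewrite !expg0 mulg1 mul1g.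
by rewrite expgSr mulgA IHk expgSr !mulgA.
Qed.

Lemma simple_mul_expV (s t : simple S) k :
  ((val s * val t) ^+ k)^-1 = (val t * val s) ^+ k.
Proof. by rewrite -expVgn invMg !simpleV. Qed.

(** The first component is meant to be a reflection and the Boolean its sign; letting it range over
    all of W keeps the underlying set a plain finite type. *)
Definition reflect_fun (s : simple S) (p : W * bool) : W * bool :=
  (p.1 ^ val s, p.2 (+) (p.1 == val s)).

Lemma reflect_funK s : cancel (reflect_fun s) (reflect_fun s).
Proof.
case=> r e; rewrite /reflect_fun /= -conjgM simple_sqr conjg1; congr (_, _).
have -> : (r ^ val s == val s) = (r == val s).
  have ss : val s ^ val s = val s by rewrite conjgE mulKg.
  by rewrite -{2}ss (inj_eq (conjg_inj _)).
by rewrite -addbA addbb addbF.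
Qed.

Definition reflect_perm s : {perm (W * bool)} := perm (can_inj (reflect_funK s)).

(** Each letter flips the sign of a single first component; pulled back to the start of the product,
    the test made by letter number j reads r = (st)^j s. *)
Lemma reflect_perm_exp s t k r e :
  ((reflect_perm s * reflect_perm t) ^+ k) (r, e) =
  (r ^ ((val s * val t) ^+ k),
   e (+) odd (\sum_(j < k.*2) (r == (val s * val t) ^+ j * val s)%g)).
Proof.
elim: k => [|k IHk]; first by rewrite !expg0 perm1 conjg1 big_ord0 addbF.
rewrite expgSr permM IHk permM !permE /reflect_fun /= -!conjgM.
rewrite doubleS !big_ord_recr /= !oddD !oddb expgSr ?mulgA; congr (_, _).
rewrite -!addbA; congr (_ (+) (_ (+) _)).
have conjE (y z : W) : (r ^ y == z) = (r == z ^ y^-1).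
  by rewrite -(inj_eq (conjg_inj y) r) conjgKV.
rewrite !conjE !conjgE !invgK invMg simpleV !simple_mul_expV.
by rewrite -!mulgA !simple_mul_expC -addnn -addSn !expgD expgSr !mulgA.
Qed.

(** The elements (st)^j s repeat with period [coxeter_order s t], so over two periods every test
    occurs twice and the sign flips cancel. *)
Lemma reflect_perm_rel (s t : simple S) :
  (reflect_perm s * reflect_perm t) ^+ coxeter_order s t = 1.
Proof.
apply/permP => -[r e]; rewrite reflect_perm_exp perm1 expg_order conjg1.
set a := val s * val t.
have -> : odd (\sum_(j < (coxeter_order s t).*2) (r == a ^+ j * val s)%g) = false.
  rewrite -addnn big_split_ord /= -[RHS](addbb
    (odd (\sum_(i < coxeter_order s t) (r == a ^+ i * val s)%g))) oddD.
  congr (_ (+) odd _); apply: eq_bigr => i _.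
  by rewrite expgD expg_order mul1g.
by rewrite addbF.
Qed.

(* [N x] is the set of left inversions of [x]: the reflections [r] for which
   [r * x] is shorter than [x]. *)
Lemma inversion_cocycle :
  exists N : W -> {set W},
    (forall s : simple S, N (val s) = [set val s]) /\
    (forall x y r, (r \in N (x * y)) = (r \in N x) (+) (r ^ x \in N y)).
Proof.
(* The presentation of W turns [reflect_perm] into an action F of W; N x collects the r whose sign F
   x flips. *)
have [_ _ /(_ {perm (W * bool)} reflect_perm reflect_perm_rel) [F FM Fs]] := WS.
have F1 : F 1 = 1.
  by apply: (mulgI (F 1)); rewrite -FM !mulg1.
have FE x r e : F x (r, e) = (r ^ x, e (+) (F x (r, false)).2).
  have [c <-] := exists_word x; elim: c r e => [|s c IHc] r e.
    by rewrite wprod_nil F1 !perm1 conjg1 /= addbF.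
  rewrite wprod_cons FM !permM Fs !permE /reflect_fun /= IHc.
  by rewrite [in RHS]IHc conjgM /= addbA.
exists (fun x => [set r | (F x (r, false)).2]); split=> [s|x y r].
  by apply/setP => r; rewrite !inE Fs permE /reflect_fun.
by rewrite !inE FM permM (FE x) FE.
Qed.

Definition inversions : W -> {set W} := sval (cid inversion_cocycle).

Lemma inversions_simple (s : simple S) : inversions (val s) = [set val s].
Proof. by have [+ _] := svalP (cid inversion_cocycle); apply. Qed.

Lemma inversionsM x y r :
  (r \in inversions (x * y)) = (r \in inversions x) (+) (r ^ x \in inversions y).
Proof. by have [_ +] := svalP (cid inversion_cocycle); apply. Qed.

Lemma inversions1 : inversions 1 = finset.set0.
Proof.
by apply/setP => r; rewrite inE -[1]mulg1 inversionsM conjg1 addbb.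
Qed.

Lemma inversions_simpleM (s : simple S) w r :
  (r \in inversions (val s * w)) = (r == val s) (+) (r ^ val s \in inversions w).
Proof. by rewrite inversionsM inversions_simple inE. Qed.

(** Running through the word, r is conjugated by each letter passed until it equals the next one;
    deleting that letter amounts to multiplying by r on the left. *)
Lemma word_exchange (c : word) r : r \in inversions (wprod c) ->
  exists2 d : word, size c = (size d).+1 & wprod d = r * wprod c.
Proof.
elim: c r => [|s c IHc] r; first by rewrite wprod_nil inversions1 inE.
rewrite wprod_cons inversions_simpleM; have [-> _|_ /IHc[d sz_d dE]] := eqVneq.
  by exists c; rewrite ?simpleK.
exists (s :: d); rewrite /= ?sz_d // wprod_cons dE conjgE simpleV !mulgA.
by rewrite simple_sqr mul1g.
Qed.

(** * Length, reduced words and the exchange condition *)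

Lemma exists_word_size w :
  exists n, `[< exists2 c : word, size c = n & wprod c = w >].
Proof.
by have [c cE] := exists_word w; exists (size c); apply/asboolP; exists c.
Qed.

Definition len w : nat := ex_minn (exists_word_size w).

Lemma reduced_word_ex w : exists2 c : word, size c = len w & wprod c = w.
Proof. by rewrite /len; case: ex_minnP => n /asboolP. Qed.

Lemma len_wprod (c : word) : len (wprod c) <= size c.
Proof.
by rewrite /len; case: ex_minnP => n _; apply; apply/asboolP; exists c.
Qed.

Lemma len1 : len 1 = 0.
Proof. by apply/eqP; rewrite -leqn0 -wprod_nil len_wprod. Qed.

Lemma len_eq0 w : (len w == 0) = (w == 1).
Proof.
apply/eqP/eqP => [w0|->]; last exact: len1.
by have [c + <-] := reduced_word_ex w; rewrite w0 => /size0nil ->; rewrite wprod_nil.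
Qed.

Lemma len_simple (s : simple S) : len (val s) = 1%N.
Proof.
have [ordS _ _] := WS.
apply/eqP; rewrite eqn_leq; apply/andP; split.
  by rewrite -[val s]mulg1 -wprod_nil -wprod_cons len_wprod.
by rewrite lt0n len_eq0 -order_eq1 ordS // (valP s).
Qed.

Lemma len_mul x y : len (x * y) <= len x + len y.
Proof.
have [c <- <-] := reduced_word_ex x; have [d <- <-] := reduced_word_ex y.
by rewrite -size_cat -wprod_cat len_wprod.
Qed.

Lemma strong_exchange w r : r \in inversions w -> len (r * w) < len w.
Proof.
have [c <- <-] := reduced_word_ex w; move=> /word_exchange[d -> <-].
by rewrite ltnS len_wprod.
Qed.

Lemma simple_inversion (s : simple S) w :
  (val s \in inversions w) = (len (val s * w) < len w).
Proof.
apply/idP/idP => [/strong_exchange //|].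
(* Conjugation by [val s] fixes [val s], which is therefore an inversion of exactly one of w and s
   w. *)
have ss : val s ^ val s = val s by rewrite conjgE mulKg.
rewrite -{2 3}[w](simpleK s) inversions_simpleM eqxx ss addTb.
by apply: contraL => /strong_exchange /ltnW; rewrite -leqNgt.
Qed.

Definition reduced (c : word) := size c == len (wprod c).

Lemma reduced_behead s c : reduced (s :: c) -> reduced c.
Proof.
rewrite /reduced wprod_cons /= => /eqP sz_c; rewrite eqn_leq len_wprod andbT.
by rewrite -ltnS sz_c (leq_trans (len_mul _ _)) // len_simple.
Qed.

Lemma reduced_inversion (s : simple S) c :
  reduced (s :: c) -> val s \in inversions (wprod (s :: c)).
Proof.
rewrite simple_inversion {1}wprod_cons simpleK /reduced => /eqP <- /=.
by rewrite ltnS len_wprod.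
Qed.

(** * Alternating words and Matsumoto's theorem *)

Lemma alt_wprodE k (s t : simple S) :
  wprod (alt_word k s t) = (val s * val t) ^+ k * wprod (alt_word k t s).
Proof.
elim: k s t => [|k IHk] s t; first by rewrite expg0 mul1g.
rewrite /= !wprod_cons {1}IHk mulgA simple_mul_expC expgSr -!mulgA.
by rewrite simpleK.
Qed.

Lemma wprod_braid (s t : simple S) (m := coxeter_order s t) :
  wprod (alt_word m s t) = wprod (alt_word m t s).
Proof. by rewrite alt_wprodE expg_order mul1g. Qed.

Lemma inversions_alt k (s t : simple S) r :
  r \in inversions (wprod (alt_word k s t)) ->
  exists2 i, i < k & r = (val s * val t) ^+ i * val s.
Proof.
elim: k s t r => [|k IHk] s t r; first by rewrite wprod_nil inversions1 inE.
rewrite /= wprod_cons inversions_simpleM; have [-> _|_ /IHk[i ik rE]] := eqVneq.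
  by exists 0; rewrite // expg0 mul1g.
exists i.+1 => //; rewrite expgSr -2!mulgA mulgA -simple_mul_expC -mulgA.
rewrite [X in _ * X]mulgA -rE conjgE simpleV !mulgA simple_sqr mul1g.
by rewrite -mulgA simple_sqr mulg1.
Qed.

(** Were s an inversion, then s = (ts)^i t with i < k, hence (ts)^(i+1) = 1 with 0 < i + 1 <= k, and
    k is below the order of ts. *)
Lemma alt_notin_inversions k (s t : simple S) : k < coxeter_order s t ->
  val s \notin inversions (wprod (alt_word k t s)).
Proof.
rewrite coxeter_orderC => km; apply/negP => /inversions_alt[i ik sE].
have : (val t * val s) ^+ i.+1 == 1.
  by rewrite expgSr mulgA -sE simple_sqr.
rewrite -order_dvdn => /(dvdn_leq (ltn0Sn i)).
by rewrite leqNgt (leq_ltn_trans ik km).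
Qed.

(* If both [s] and [t] shorten [w], peel them off alternately: as long as
   [k < m], the letter [s] is not an inversion of the alternating word
   [t s t ...] of length [k], so it must shorten the remaining factor. *)
Lemma braid_prefix k (s t : simple S) w : k <= coxeter_order s t ->
  val s \in inversions w -> val t \in inversions w ->
  exists2 u, w = wprod (alt_word k s t) * u & len w = k + len u.
Proof.
elim: k s t => [|k IHk] s t km sw tw; first by exists w; rewrite // wprod_nil mul1g.
have [|u wE lw] := IHk t s _ tw sw; first by rewrite coxeter_orderC ltnW.
set P := wprod (alt_word k t s) in wE *.
(* As s is an inversion of P u but not of P, its conjugate s ^ P is an inversion of u, and
   multiplying u by this conjugate shortens it. *)
have := sw; rewrite {1}wE inversionsM (negbTE (alt_notin_inversions km)) addFb.
move=> /strong_exchange lt_u.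
have wE' : w = wprod (alt_word k.+1 s t) * (val s ^ P * u).
  by rewrite /= wprod_cons -/P conjgE -!mulgA mulKVg simpleK.
exists (val s ^ P * u) => //; apply/eqP; rewrite eqn_leq; apply/andP; split.
  rewrite {1}wE' (leq_trans (len_mul _ _)) // leq_add2r.
  by rewrite (leq_trans (len_wprod _)) // size_alt_word.
by rewrite lw addSn -addnS leq_add2l.
Qed.

(** Matsumoto's theorem, by induction on the length. When the first letters s and t differ, both
    shorten the common product w, so w has reduced words starting with either alternating word of
    length m; induction links c and d to these, and the braid relation links the two. *)
Lemma reduced_eq_braid (A : pzRingType) (x : simple S -> A) :
  (forall s t, s != t -> (\prod_(r <- alt_word (coxeter_order s t) s t) x r =
                          \prod_(r <- alt_word (coxeter_order s t) t s) x r)%R) ->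
  forall c d : word, reduced c -> reduced d -> wprod c = wprod d ->
  (\prod_(r <- c) x r = \prod_(r <- d) x r)%R.
Proof.
move=> braid c; have [n] := ubnP (size c); elim: n c => // n IHn c sz_c d rc rd cd.
have sz_cd : size c = size d by rewrite (eqP rc) (eqP rd) cd.
case: c sz_c rc cd sz_cd => [|s c] sz_c rc cd sz_cd; first by case: d sz_cd {rd cd}.
case: d rd cd sz_cd => [|t d] // rd cd [sz_cd].
have rc' := reduced_behead rc.
have rd' := reduced_behead rd.
have [st|nst] := eqVneq s t.
  move: cd; rewrite !big_cons st !wprod_cons => /mulgI cd.
  by rewrite (IHn c _ d).
have sw := reduced_inversion rc; have tw := reduced_inversion rd.
rewrite -cd in tw; set w := wprod (s :: c) in sw tw cd.
set m := coxeter_order s t; have m_gt0 : 0 < m by exact: order_gt0.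
have [u wE lw] := braid_prefix (leqnn m) sw tw.
have [e sz_e eE] := reduced_word_ex u.
(* Once the common first letter p is cancelled, both sides are reduced words of one element, short
   enough for the induction hypothesis. *)
have step p q a : m = coxeter_order p q -> reduced (p :: a) -> size a < n ->
    wprod (p :: a) = w -> w = wprod (alt_word m p q) * u ->
    (\prod_(r <- p :: a) x r = \prod_(r <- alt_word m p q ++ e) x r)%R.
  move=> mE rpa sz_a aE wE'.
  have fE : wprod (alt_word m p q ++ e) = w by rewrite wprod_cat eE -wE'.
  have rf : reduced (alt_word m p q ++ e).
    by rewrite /reduced fE size_cat size_alt_word sz_e lw.
  have altE : alt_word m p q = p :: alt_word m.-1 q p.
    by case: m m_gt0 {mE lw wE wE' fE rf}.
  move: rf fE; rewrite altE cat_cons => rf fE.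
  have ra := reduced_behead rpa.
  have rf' := reduced_behead rf.
  rewrite !big_cons (IHn a sz_a _ ra rf') //.
  by apply: (mulgI (val p)); rewrite -!wprod_cons fE.
rewrite (step s t) // (step t s) //.
- by rewrite !big_cat /= braid.
- exact: coxeter_orderC.
- by rewrite -sz_cd.
- by rewrite wE wprod_braid.
Qed.

End CoxeterWords.

Local Open Scope classical_set_scope.
Local Open Scope ring_scope.

(** * Ideals, algebras and bases *)

Lemma malg_sumE (R : nzRingType) (X : choiceType) (f : {malg R[X]}) :
  f = \sum_(k <- msupp f) f@_k *: << k >>.
Proof.
rewrite {1}[f]monalgE; apply: eq_bigr => k _.
by apply/malgP => l; rewrite mcoeffZ !mcoeffU mulrnAr mulr1.
Qed.

Lemma malg_basis_ind (R : nzRingType) (X : choiceType) (P : {malg R[X]} -> Prop) :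
  P 0 -> (forall f g, P f -> P g -> P (f + g)) ->
  (forall a k, P (a *: << k >>)) -> forall f, P f.
Proof. by move=> P0 PD PZ f; rewrite [f]malg_sumE; apply: big_ind. Qed.

Lemma kernel_is_ideal (A B : pzRingType) (g : {rmorphism A -> B}) :
  is_ideal [set u | g u = 0].
Proof.
split; first split=> [|x y /= gx gy|a x /= gx].
- exact: rmorph0.
- by rewrite rmorphD gx gy addr0.
- by rewrite rmorphM gx mulr0.
by move=> a x /= gx; rewrite rmorphM gx mul0r.
Qed.

Definition kernel (A B : pzRingType) (g : {rmorphism A -> B}) : ideal A :=
  Ideal (kernel_is_ideal g).

(** If a maximal left ideal M misses x, then 1 = m + y x with m in M. So y x is 1 modulo M, and so
    are all its powers, among them 0. *)
Lemma jacobson_nil (B : pzRingType) (x : B) :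
  (forall y, exists n, (y * x) ^+ n = 0) -> jacobson_set x.
Proof.
move=> nil M [[M0 MD MM] MT Mmax]; apply: contrapT => nMx.
pose L : set B := [set z | exists m y, M m /\ z = m + y * x].
have lL : is_left_ideal L.
  split; first by exists 0, 0; rewrite mul0r addr0.
  - move=> _ _ [m [y [Mm ->]]] [m' [y' [Mm' ->]]]; exists (m + m'), (y + y').
    by split; [exact: MD | rewrite mulrDl addrACA].
  - move=> b _ [m [y [Mm ->]]]; exists (b * m), (b * y).
    by split; [exact: MM | rewrite mulrDr mulrA].
have ML : M `<=` L by move=> m Mm; exists m, 0; rewrite mul0r addr0.
case: (Mmax L lL ML) => LE.
  by apply: nMx; rewrite -LE; exists 0, 1; rewrite mul1r add0r.
have [m [y [Mm yE]]] : L 1 by rewrite LE.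
have [n yn] := nil y.
apply: MT; apply: left_ideal1 => //.
rewrite -[1]subr0 -yn; elim: n {yn} => [|n IHn]; first by rewrite expr0 subrr.
rewrite exprS (_ : 1 - _ = y * x * (1 - (y * x) ^+ n) + m).
  by apply: MD => //; apply: MM.
by rewrite mulrBr mulr1 addrAC [_ + m]addrC -yE.
Qed.

(** For y outside the kernel, g y is invertible in K; a lift b of its inverse puts 1 - b y in the
    kernel, so the kernel and y together generate 1. *)
Lemma kernel_maximal (B : pzRingType) (K : fieldType) (g : {rmorphism B -> K}) :
  (forall k, exists b, g b = k) -> is_maximal_left_ideal [set u | g u = 0].
Proof.
move=> gsurj; have [lk _] := kernel_is_ideal g; split=> // [gE|L [L0 LD LM] kL].
  have : [set u | g u = 0] 1 by rewrite gE.
  by rewrite /= rmorph1 => /eqP; rewrite oner_eq0.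
have [Lk|/existsNP[y /not_implyP[Ly gy]]] := pselect (L `<=` [set u | g u = 0]).
  by left; apply/seteqP.
right; apply: left_ideal1 => //.
have [b gb] := gsurj (g y)^-1.
rewrite -(subrK (b * y) 1); apply: LD; last exact: LM.
by apply: kL; rewrite /= rmorphB rmorphM rmorph1 gb mulVf ?subrr //; apply/eqP.
Qed.

Lemma quotient_lift (R : pzRingType) (A : pzAlgType R) (B : pzRingType)
    (X : set A) (g : {rmorphism A -> B}) : (forall u, X u -> g u = 0) ->
  exists h : {rmorphism quotient_alg (ideal_gen X) -> B},
    forall u, h (proj_quot _ u) = g u.
Proof.
move=> gX; pose h (y : quotient_alg (ideal_gen X)) : B := g (repr_quot y).
have hE u : h (proj_quot _ u) = g u.
  apply/eqP; rewrite -subr_eq0 -rmorphB; apply/eqP.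
  by have := repr_proj_quot (ideal_gen X) u => /(_ _ (kernel_is_ideal g)); apply.
have hB : zmod_morphism h.
  move=> x y; rewrite -[x]repr_quotK -[y]repr_quotK -raddfB.
  by rewrite !hE rmorphB.
have hM : GRing.monoid_morphism h.
  split=> [|x y]; first by rewrite -[RHS](rmorph1 g) -hE rmorph1.
  by rewrite -[x]repr_quotK -[y]repr_quotK -rmorphM !hE rmorphM.
pose hZ := GRing.isZmodMorphism.Build _ _ h hB.
pose hMM := GRing.isMonoidMorphism.Build _ _ h hM.
pose H : {rmorphism quotient_alg (ideal_gen X) -> B} := HB.pack h hZ hMM.
by exists H.
Qed.

Lemma ideal_mul_mem (A : pzRingType) (I J : ideal A) x y :
  ideal_set I x -> ideal_set J y -> ideal_set (ideal_mul I J) (x * y).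
Proof.
move=> Ix Jy; exists [:: (x, y)]; rewrite big_seq1; split=> // u.
by rewrite inE => /eqP->.
Qed.

Lemma ideal_sum (A : pzRingType) (I : ideal A) (T : eqType) (s : seq T)
    (F : T -> A) :
  (forall t, t \in s -> ideal_set I (F t)) -> ideal_set I (\sum_(t <- s) F t).
Proof.
have [[I0 ID _] _] := idealP I.
by move=> IF; rewrite big_seq; apply: big_ind.
Qed.

Lemma idealZ (R : pzRingType) (A : pzAlgType R) (I : ideal A) a x :
  ideal_set I x -> ideal_set I (a *: x).
Proof.
have [[_ _ IM] _] := idealP I => Ix.
by rewrite -[x]mul1r pzalg_scalerAl; apply: IM.
Qed.

Lemma basis_image (R : pzRingType) (M M' : lmodType R) (I : eqType) (b : I -> M)
  (f : {linear M -> M'}) : bijective f -> is_basis b -> is_basis (f \o b).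
Proof.
move=> [g fK gK] [bind bgen].
have fE s (c : I -> R) :
    \sum_(i <- s) c i *: (f \o b) i = f (\sum_(i <- s) c i *: b i).
  by rewrite raddf_sum; apply: eq_bigr => i _; rewrite /= linearZ.
split=> [s c us|v].
  rewrite fE => /(congr1 g); rewrite fK => s0; apply: bind => //.
  by rewrite s0 -(raddf0 f) fK.
by have [s [c vE]] := bgen (g v); exists s, c; rewrite fE -vE /= gK.
Qed.

Lemma first_isomorphism (R : pzRingType) (A B : pzAlgType R) (phi : {linear A -> B})
    (I : ideal A) :
  GRing.monoid_morphism phi -> (forall y, exists x, phi x = y) ->
  (forall x, ideal_set I x <-> phi x = 0) -> algebra_isomorphic B (quotient_alg I).
Proof.
move=> [phi1 phiM] surj kerE.
have eqE x y : proj_quot I x = proj_quot I y <-> phi x = phi y.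
  split=> [/proj_quot_eq/kerE|xy].
    by rewrite raddfB => /subr0_eq.
  by apply/proj_quot_eq/kerE; rewrite raddfB; apply/eqP; rewrite subr_eq0; apply/eqP.
pose f y := proj_quot I (sval (cid (surj y))).
have fE x : f (phi x) = proj_quot I x.
  by apply/eqE; exact: svalP (cid (surj (phi x))).
exists f; split.
- move=> a x y; have [u <-] := surj x; have [v <-] := surj y.
  by rewrite -linearP !fE linearP.
- split; first by rewrite -phi1 fE rmorph1.
  move=> x y; have [u <-] := surj x; have [v <-] := surj y.
  by rewrite -phiM !fE rmorphM.
exists (fun q => phi (repr_quot q)) => [y|q].
  by have [x <-] := surj y; apply/eqE; rewrite fE repr_quotK.
by rewrite fE repr_quotK.
Qed.

(** The first hypothesis expresses, as an induction principle, that [w] spans A. The action [scale]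
    is abstract so that the target can be the scalars as well as an algebra. *)
Lemma multiplicative_ext (R : comNzRingType) (A : pzAlgType R) (B : pzRingType)
    (T : Type) (w : T -> A) (phi : {additive A -> B}) (scale : R -> B -> B) :
  (forall P : A -> Prop, P 0 -> (forall f g, P f -> P g -> P (f + g)) ->
     (forall a t, P (a *: w t)) -> forall f, P f) ->
  (forall a x y, scale a (x * y) = scale a x * y) ->
  (forall a x y, scale a (x * y) = x * scale a y) ->
  (forall a x, phi (a *: x) = scale a (phi x)) ->
  (forall s t, phi (w s * w t) = phi (w s) * phi (w t)) ->
  {morph phi : x y / x * y}.
Proof.
move=> ind scaleAl scaleAr phiZ phiM a b; elim/ind: a => [|a a' IH IH'|a s].
- by rewrite !(mul0r, raddf0).
- by rewrite mulrDl !raddfD /= IH IH' mulrDl.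
rewrite -pzalg_scalerAl !phiZ -scaleAl; congr scale.
elim/ind: b => [|b b' IH IH'|b t].
- by rewrite !(mulr0, raddf0).
- by rewrite mulrDr !raddfD /= IH IH' mulrDr.
by rewrite -pzalg_scalerAr !phiZ phiM -scaleAr.
Qed.

(** * Linear extension, forms vanishing on ideals, words in free algebras *)

Section LinearExtension.
Variables (R : nzRingType) (X : choiceType) (V : lmodType R) (b : X -> V).

Definition malg_lin (f : {malg R[X]}) : V := \sum_(k <- msupp f) f@_k *: b k.

Lemma malg_linEw (d : {fset X}) f : (msupp f `<=` d)%fset ->
  malg_lin f = \sum_(k <- d) f@_k *: b k.
Proof.
move=> le; rewrite [LHS](big_fset_incl _ le) => //= k _ /mcoeff_outdom ->.
by rewrite scale0r.
Qed.

Lemma malg_lin_is_linear : linear malg_lin.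
Proof.
move=> a f g; pose d := (msupp f `|` msupp g)%fset.
have sf : (msupp f `<=` d)%fset by apply: fsubsetUl.
have sg : (msupp g `<=` d)%fset by apply: fsubsetUr.
have sfg : (msupp (a *: f + g) `<=` d)%fset.
  apply: (fsubset_trans (msuppD_le _ _)); apply: fsetUSS => //.
  exact: msuppZ_le.
rewrite (malg_linEw sf) (malg_linEw sg) (malg_linEw sfg) scaler_sumr -big_split.
by apply: eq_bigr => k _ /=; rewrite mcoeffD mcoeffZ scalerDl scalerA.
Qed.

HB.instance Definition _ :=
  GRing.isLinear.Build R {malg R[X]} V *:%R malg_lin malg_lin_is_linear.

Lemma malg_linU k : malg_lin << k >> = b k.
Proof. by rewrite (malg_linEw msuppU_le) big_seq_fset1 mcoeffUU scale1r. Qed.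

End LinearExtension.

(** This is the largest ideal on which all the forms vanish; for the forms to vanish on a generated
    ideal, it suffices that the generators lie in it. *)
Lemma largest_ideal_in_kernels (A : pzRingType) (V : zmodType) (T : Type)
  (phi : T -> {additive A -> V}) :
  is_ideal [set u : A | forall a b i, phi i (a * u * b) = 0].
Proof.
split; first split=> [a b i|x y Ix Iy a b i|c x Ix a b i].
- by rewrite mulr0 mul0r raddf0.
- by rewrite mulrDr mulrDl raddfD /= Ix Iy addr0.
- by rewrite mulrA Ix.
by move=> c x Ix a b i; rewrite mulrA -mulrA Ix.
Qed.

Lemma bilinear_ext (R : comNzRingType) (A : pzAlgType R) (T : Type) (w : T -> A) :
  (forall P : A -> Prop, P 0 -> (forall f g, P f -> P g -> P (f + g)) ->
     (forall a t, P (a *: w t)) -> forall f, P f) ->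
  forall (phi : {linear A -> R | *%R}) x,
  (forall s t, phi (w s * x * w t) = 0) -> forall a b, phi (a * x * b) = 0.
Proof.
move=> ind phi x phi0 a b; elim/ind: a => [|a a' IH IH'|a s].
- by rewrite !mul0r raddf0.
- by rewrite !mulrDl raddfD /= IH IH' addr0.
rewrite -!pzalg_scalerAl linearZ /= -[RHS](mulr0 a); congr (_ * _).
elim/ind: b => [|b b' IH IH'|b t].
- by rewrite mulr0 raddf0.
- by rewrite mulrDr raddfD /= IH IH' addr0.
by rewrite -pzalg_scalerAr linearZ /= phi0 mulr0.
Qed.

Section FreeWords.
Variables (R : comNzRingType) (X : choiceType).
Local Notation F := (free_alg R X).

Definition free_word (c : seq X) : F := << fmonom_of_seq fmonom_key c >>.

Lemma free_wordE (m : {fmonom X}) : << m >> = free_word m :> F.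
Proof. by congr << _ >>; apply: val_inj; rewrite /= fmE. Qed.

Lemma free_word_cat c d : free_word (c ++ d) = free_word c * free_word d.
Proof.
rewrite /free_word malgME !msuppU !oner_eq0 !big_seq_fset1 !mcoeffUU mulr1.
by congr << _ >>; apply: val_inj; rewrite /= fmM !fmE.
Qed.

Lemma free_word_nil : free_word [::] = 1.
Proof. by congr << _ >>; apply: val_inj; rewrite /= fm1 fmE. Qed.

Lemma free_word_prod c : \prod_(s <- c) free_gen R s = free_word c.
Proof.
elim: c => [|s c IHc]; first by rewrite big_nil free_word_nil.
by rewrite big_cons IHc -cat1s free_word_cat.
Qed.

Lemma free_word_ind (P : F -> Prop) :
  P 0 -> (forall f g, P f -> P g -> P (f + g)) ->
  (forall a c, P (a *: free_word c)) -> forall f, P f.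
Proof.
move=> P0 PD PZ; apply: malg_basis_ind => // a m.
by rewrite free_wordE; apply: PZ.
Qed.

End FreeWords.

Arguments free_word {R X} c.

(** * The radical of a scalar extension *)

Section Tensor.
Variables (R K : comNzRingType) (f : {rmorphism R -> K}) (A : pzAlgType R).

Local Notation T := (tensor_alg f A).
Local Notation F := (free_alg R (K * A)%type).
Local Notation tensor := (@tensor R K f A).

Lemma tensorDr k n n' : tensor k (n + n') = tensor k n + tensor k n'.
Proof. by have := tensor_relP (tensor_addr f k n n'); rewrite raddfD. Qed.

Lemma tensorZ a k n : a *: tensor k n = tensor k (a *: n).
Proof. by have := tensor_relP (tensor_scaler f a k n); rewrite linearZ. Qed.

Lemma tensorM k k' n n' : tensor k n * tensor k' n' = tensor (k * k') (n * n').
Proof. by have := tensor_relP (tensor_mul f k k' n n'); rewrite rmorphM. Qed.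

Lemma tensor11 : tensor 1 1 = 1.
Proof. by have := tensor_relP (tensor_one f A); rewrite rmorph1. Qed.

Lemma tensor0 k : tensor k 0 = 0.
Proof. by apply: (addrI (tensor k 0)); rewrite -tensorDr !addr0. Qed.

Definition tensor_span (D : set A) : set T := [set y | exists s : seq (K * A),
  (forall p, p \in s -> D p.2) /\ y = \sum_(p <- s) tensor p.1 p.2].

Lemma tensor_spanM (D E G : set A) y z :
  (forall m n, D m -> E n -> G (m * n)) ->
  tensor_span D y -> tensor_span E z -> tensor_span G (y * z).
Proof.
move=> DEG [s [sD ->]] [t [tE ->]].
exists [seq (p.1 * q.1, p.2 * q.2) | p <- s, q <- t]; split.
  by move=> _ /allpairsP[[p q] /= [/sD Dp /tE Eq ->]]; apply: DEG.
rewrite big_allpairs_dep mulr_suml; apply: eq_bigr => p _; rewrite mulr_sumr.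
by apply: eq_bigr => q _; rewrite tensorM.
Qed.

(** By construction an element is a combination of products of pure tensors; the relations for 1 and
    for products collapse each product, and scalars move into the second factor. *)
Lemma tensor_spanT y : tensor_span setT y.
Proof.
have span1 k n : tensor_span setT (tensor k n).
  by exists [:: (k, n)]; rewrite big_seq1.
have spanD u v : tensor_span setT u -> tensor_span setT v ->
    tensor_span setT (u + v).
  by move=> [s [_ ->]] [t [_ ->]]; exists (s ++ t); rewrite big_cat.
rewrite -[y]repr_quotK.
elim/free_word_ind: (repr_quot y) => [|u v Pu Pv|a c].
- by exists [::]; rewrite big_nil raddf0.
- by rewrite raddfD; apply: spanD.
rewrite linearZ /= -free_word_prod rmorph_prod /=.
have [s [_ ->]] : tensor_span setT
    (\prod_(p <- c) presented_gen (@tensor_rel R K f A) p).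
  elim: c => [|p c IHc].
    by rewrite big_nil -tensor11; apply: span1.
  rewrite big_cons; apply: (@tensor_spanM setT setT) IHc => //.
  by case: p => k n; apply: span1.
exists [seq (p.1, a *: p.2) | p <- s]; split=> //.
by rewrite big_map scaler_sumr; apply: eq_bigr => p _; rewrite tensorZ.
Qed.

(** A left multiple of the image of x is a sum of pure tensors with second entries in D; those of
    its n-th power lie in D^n, so that power is 0. *)
Lemma tensor_incl_jacobson (D : ideal A) x :
  (exists n, ideal_exp D n `<=` [set 0]) ->
  ideal_set D x -> jacobson_set (tensor_incl f x).
Proof.
move=> [n Dn] Dx; have [[_ _ MD] _] := idealP D.
apply: jacobson_nil => y; exists n.
have Dyx : tensor_span D (y * tensor_incl f x).
  apply: (@tensor_spanM setT [set x]) => [m _ _ ->||].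
  - exact: MD.
  - exact: tensor_spanT.
  by exists [:: (1, x)]; rewrite big_seq1; split=> // p; rewrite inE => /eqP->.
have : tensor_span (ideal_exp D n) ((y * tensor_incl f x) ^+ n).
  elim: (n) => [|m IHm]; first exact: tensor_spanT.
  rewrite exprS; apply: tensor_spanM Dyx IHm => a b Da Eb.
  by exists [:: (a, b)]; rewrite big_seq1; split=> // u; rewrite inE => /eqP->.
move=> [s [sD ->]]; rewrite big1_seq // => p /andP[_ /sD/Dn ->].
exact: tensor0.
Qed.

End Tensor.

Section TensorAugmentation.
Variables (R : comNzRingType) (K : fieldType) (f : {rmorphism R -> K}).
Variables (A : pzAlgType R) (e : {rmorphism A -> R}).
Hypothesis eZ : scalable_for *%R e.

Local Notation T := (tensor_alg f A).
Local Notation F := (free_alg R (K * A)%type).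

Let aug_word (m : {fmonom (K * A)%type}) : K := \prod_(p <- m) (p.1 * f (e p.2)).

Let aug_word_mmorphism : mmorphism aug_word.
Proof.
split=> [m m'|]; first by rewrite /aug_word fmM big_cat.
by rewrite /aug_word fm1 big_nil.
Qed.

HB.instance Definition _ := monalg.isMultiplicative.Build _ K aug_word
  aug_word_mmorphism.

(** This is the scalar extension of e to K: the values k * f (e n) are multiplied along words of the
    free algebra, and every defining relation is sent to 0. *)
Lemma tensor_augmentation :
  exists g : {rmorphism T -> K}, forall k n, g (tensor f k n) = k * f (e n).
Proof.
pose G : {rmorphism F -> K} := mmap f aug_word.
have Gpure k n : G (pure k n) = k * f (e n).
  by rewrite /G /= mmapU /= rmorph1 mul1r /aug_word fmuE big_seq1.
have GZ a u : G (a *: u) = f a * G u by apply: mmapZ.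
have Grel u : @tensor_rel R K f A u -> G u = 0.
  have GB v w : G (v - w) = G v - G w by exact: rmorphB.
  have GD v w : G (v + w) = G v + G w by exact: rmorphD.
  have GM v w : G (v * w) = G v * G w by exact: rmorphM.
  have G1 : G 1 = 1 by exact: rmorph1.
  case=> [k k' n|k n n'|a k n|a k n||k k' n n'].
  - by rewrite GB GD !Gpure mulrDl subrr.
  - by rewrite GB GD !Gpure !rmorphD mulrDr subrr.
  - by rewrite GB GZ !Gpure mulrA subrr.
  - by rewrite GB GZ !Gpure eZ rmorphM mulrCA subrr.
  - by rewrite GB G1 Gpure !rmorph1 mulr1 subrr.
  by rewrite GB GM !Gpure !rmorphM mulrACA subrr.
have [g gE] := quotient_lift Grel.
by exists g => k n; rewrite gE Gpure.
Qed.

(** The scalar extension of e is onto K, so its kernel is a maximal left ideal and contains the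
    radical. *)
Lemma tensor_jacobson_aug x : jacobson_set (tensor_incl f x) -> f (e x) = 0.
Proof.
have [g gE] := tensor_augmentation.
have /kernel_maximal gmax k : exists b, g b = k.
  by exists (tensor f k 1); rewrite gE !rmorph1 mulr1.
by move=> /(_ _ gmax) /=; rewrite gE mul1r.
Qed.

End TensorAugmentation.

Lemma tensor_jacobson_preimage (R : comNzRingType) (K : fieldType)
    (f : {rmorphism R -> K}) (A : pzAlgType R) (e : {rmorphism A -> R}) :
  injective f -> scalable_for *%R e ->
  (exists n, ideal_exp (kernel e) n `<=` [set 0]) ->
  ideal_preimage (tensor_incl f (A := A)) (jacobson (tensor_alg f A)) =
    kernel e :> set A.
Proof.
move=> finj eZ nil; apply/seteqP; split=> x /=.
  by move=> /(tensor_jacobson_aug eZ) /eqP; rewrite (raddf_eq0 _ finj) => /eqP.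
by move=> ex0; apply: (@tensor_incl_jacobson R K f A (kernel e) x nil ex0).
Qed.

(** * The nilCoxeter algebra *)

Section NilCoxeterBasis.
Variables (O : idomainType) (W : finGroupType) (S : {set W}).
Hypothesis WS : is_coxeter_system S.
Local Notation N := (nilcoxeter O S).
Local Notation word := (seq (simple S)).
Local Notation F := (free_alg O (simple S)).
Local Notation rel := (@nilcoxeter_rel O W S).
Local Notation proj := (@proj_quot O F (ideal_gen rel)).

Lemma braid_word_alt (s t : simple S) m :
  braid_word O s t m = free_word (alt_word m s t).
Proof.
rewrite -free_word_prod /braid_word; elim: m s t => [|m IHm] s t.
  by rewrite big_ord0 big_nil.
rewrite big_ord_recl /= big_cons -IHm; congr (_ * _).
by apply: eq_bigr => i _; rewrite /= /bump /=; case: odd.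
Qed.

Definition free_coef (w : W) : F -> O := malg_lin (V := O^o)
  (fun m : {fmonom simple S} => ((size m == len WS w) && (wprod m == w))%:R).

Lemma free_coef_is_linear w : linear_for *%R (free_coef w).
Proof. by move=> a f g; apply: (@malg_lin_is_linear O _ O^o). Qed.

HB.instance Definition _ w :=
  GRing.isLinear.Build O F O *%R (free_coef w) (free_coef_is_linear w).

Lemma free_coef_word w c :
  free_coef w (free_word c) = ((size c == len WS w) && (wprod c == w))%:R.
Proof. by rewrite /free_coef malg_linU fmE. Qed.

(** The relations lie in the largest ideal killed by all these forms; by bilinearity, this is tested
    by multiplying with words on both sides. *)
Lemma free_coef_rel w u : ideal_set (ideal_gen rel) u -> free_coef w u = 0.
Proof.
pose I : set F := [set u | forall a b w, free_coef w (a * u * b) = 0].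
have iI : is_ideal I := largest_ideal_in_kernels free_coef.
have wordI x :
    (forall c d v, free_coef v (free_word c * x * free_word d) = 0) -> I x.
  move=> x0 a b v; move: a b.
  apply: (bilinear_ext (@free_word_ind O (simple S)) (phi := free_coef v)) => c d.
  exact: x0.
have relI : rel `<=` I.
  move=> _ [s|s t st]; apply: wordI => c d v.
    rewrite (_ : free_gen O s ^+ 2 = free_word [:: s; s]); last first.
      by rewrite -free_word_prod !big_cons big_nil mulr1 expr2.
    (* The word c s s d has the same product as the shorter word c d, so it cannot be reduced. *)
    rewrite -!free_word_cat free_coef_word; case: eqP => //= sz.
    case: eqP => // vE; have := len_wprod WS (c ++ d); rewrite leqNgt.
    move: vE; rewrite !wprod_cat !wprod_cons wprod_nil mulg1 (simple_sqr WS) mulg1.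
    move=> ->; rewrite -sz !size_cat ltn_add2r -[ltnLHS]addn0 ltn_add2l.
    by [].
  rewrite mulrBr mulrBl raddfB /= !braid_word_alt -!free_word_cat !free_coef_word.
  rewrite !size_cat !size_alt_word !wprod_cat wprod_braid //.
  exact: subrr.
by move=> /(_ I iI relI) /(_ 1 1 w); rewrite mul1r mulr1.
Qed.

Definition coef (w : W) (f : N) : O := free_coef w (repr_quot f).

Lemma coef_proj w u : coef w (proj u) = free_coef w u.
Proof.
apply/eqP; rewrite -subr_eq0 -raddfB; apply/eqP; apply: free_coef_rel.
exact: repr_proj_quot.
Qed.

Lemma coef_is_linear w : linear_for *%R (coef w).
Proof.
move=> a f g; rewrite -[f]repr_quotK -[g]repr_quotK.
by rewrite -linearP !coef_proj linearP.
Qed.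

HB.instance Definition _ w :=
  GRing.isLinear.Build O N O *%R (coef w) (coef_is_linear w).

Definition nil_word (c : word) : N := \prod_(s <- c) presented_gen rel s.

Lemma nil_wordE c : nil_word c = proj (free_word c).
Proof. by rewrite -free_word_prod rmorph_prod. Qed.

Lemma nil_word_cat c d : nil_word (c ++ d) = nil_word c * nil_word d.
Proof. exact: big_cat. Qed.

Lemma coef_word w c : 
  coef w (nil_word c) = ((size c == len WS w) && (wprod c == w))%:R.
Proof. by rewrite nil_wordE coef_proj free_coef_word. Qed.

Lemma nil_word_ind (P : N -> Prop) :
  P 0 -> (forall f g, P f -> P g -> P (f + g)) ->
  (forall a c, P (a *: nil_word c)) -> forall f, P f.
Proof.
move=> P0 PD PZ f; rewrite -[f]repr_quotK; elim/free_word_ind: (repr_quot f).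
- by rewrite raddf0.
- by move=> u v Pu Pv; rewrite raddfD; apply: PD.
by move=> a c; rewrite linearZ /= -nil_wordE.
Qed.

Lemma nil_word_braid (s t : simple S) (m := coxeter_order s t) : s != t ->
  nil_word (alt_word m s t) = nil_word (alt_word m t s).
Proof.
move=> st; have := presented_rel (nilcoxeter_braid O st).
by rewrite !braid_word_alt raddfB /= -!nil_wordE => /subr0_eq.
Qed.

Lemma nil_word_eq c d : reduced WS c -> reduced WS d -> wprod c = wprod d ->
  nil_word c = nil_word d.
Proof. by apply: reduced_eq_braid => s t; apply: nil_word_braid. Qed.

(** In the main case c is reduced and s c is not. Then s is an inversion of the product of c, so c
    may be replaced by a reduced word s d, and the square of x_s appears. *)
Lemma nil_word_nonreduced c : ~~ reduced WS c -> nil_word c = 0.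
Proof.
elim: c => [|s c IHc]; first by rewrite /reduced wprod_nil len1.
have [rc|/IHc c0 _] := boolP (reduced WS c); last first.
  by rewrite /nil_word big_cons -/(nil_word c) c0 mulr0.
move=> nrsc.
have sc : val s \in inversions WS (wprod c).
  (* Otherwise s would be an inversion of the product of s c, which would be longer than that of c,
     making s c reduced. *)
  apply: contraR nrsc => sc; have : val s \in inversions WS (wprod (s :: c)).
    rewrite wprod_cons inversions_simpleM eqxx conjgE mulKg.
    by rewrite addTb.
  rewrite simple_inversion wprod_cons simpleK // => lt.
  rewrite /reduced eqn_leq len_wprod andbT wprod_cons /=.
  by rewrite (eqP rc).
have [d sz_d dE] := reduced_word_ex WS (val s * wprod c)%g.
have sdE : wprod (s :: d) = wprod c by rewrite wprod_cons dE simpleK.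
have rsd : reduced WS (s :: d).
  rewrite /reduced eqn_leq len_wprod andbT sdE /= sz_d.
  by rewrite -simple_inversion.
rewrite /nil_word big_cons -/(nil_word c) (nil_word_eq rc rsd) //.
rewrite /nil_word big_cons mulrA -expr2 -rmorphXn /=.
by rewrite presented_rel ?mul0r //; apply: nilcoxeter_square.
Qed.

Definition nil_basis (w : W) : N := nil_word (s2val (cid2 (reduced_word_ex WS w))).

Lemma nil_basisE c : reduced WS c -> nil_basis (wprod c) = nil_word c.
Proof.
rewrite /nil_basis; case: cid2 => d /= sz_d dE rc.
by apply: nil_word_eq; rewrite // /reduced sz_d dE.
Qed.

Lemma coef_basis v w : coef v (nil_basis w) = (w == v)%:R.
Proof.
rewrite /nil_basis; case: cid2 => d /= sz_d dE; rewrite coef_word sz_d dE.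
by case: (w =P v) => [->|_]; rewrite ?eqxx ?andbF.
Qed.

Lemma nil_coefE f : f = \sum_w coef w f *: nil_basis w.
Proof.
elim/nil_word_ind: f => [|f g {1}-> {1}->|a c].
- by rewrite big1 // => w _; rewrite raddf0 scale0r.
- by rewrite -big_split /=; apply: eq_bigr => w _; rewrite raddfD scalerDl.
under eq_bigr do rewrite linearZ /= coef_word -scalerA.
rewrite -scaler_sumr; congr (_ *: _).
have [rc|nrc] := boolP (reduced WS c).
  rewrite -nil_basisE // (bigD1 (wprod c)) //= eqxx andbT -/(reduced WS c) rc.
  rewrite scale1r big1 ?addr0 //.
  by move=> w wc; rewrite (eq_sym (wprod c)) (negbTE wc) andbF scale0r.
rewrite nil_word_nonreduced // big1 // => w _; case: (wprod c =P w) => [<-|_].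
  by rewrite andbT -/(reduced WS c) (negbTE nrc) scale0r.
by rewrite andbF scale0r.
Qed.

End NilCoxeterBasis.

(** * The length filtration and the powers of the augmentation ideal *)

Section Degree.
Variables (O : idomainType) (W : finGroupType) (S : {set W}).
Hypothesis WS : is_coxeter_system S.
Local Notation N := (nilcoxeter O S).
Local Notation word := (seq (simple S)).
Local Notation coef := (@coef O W S WS).
Local Notation len := (@len W S WS).

(** This is the span of the T_w with l(w) >= n; describing it by vanishing coefficients makes
    membership a linear condition. *)
Definition deg_ge n : set N := [set f | forall w, (len w < n)%N -> coef w f = 0].

Lemma nil_basis_word w :
  exists2 c : word, size c = len w & nil_basis O WS w = nil_word O c.
Proof. by rewrite /nil_basis; case: cid2 => c /= sz_c cE; exists c. Qed.

(** T_v T_u is the value of a word with l(v) + l(u) letters, and such a value has nonzero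
    coefficients only at elements whose length is the number of letters. *)
Lemma deg_geM i j f g : deg_ge i f -> deg_ge j g -> deg_ge (i + j) (f * g).
Proof.
move=> fi gj w lw.
rewrite (nil_coefE WS f) (nil_coefE WS g) mulr_suml raddf_sum big1 // => v _.
rewrite mulr_sumr raddf_sum big1 // => u _ /=.
rewrite -pzalg_scalerAl -pzalg_scalerAr !linearZ /=.
have [/fi->|iv] := ltnP (len v) i; first by rewrite mul0r.
have [/gj->|ju] := ltnP (len u) j; first by rewrite mul0r mulr0.
have [c sz_c ->] := nil_basis_word v; have [d sz_d ->] := nil_basis_word u.
rewrite -nil_word_cat coef_word size_cat sz_c sz_d eqn_leq.
rewrite [(_ <= len w)%N]leqNgt (leq_trans lw) ?mulr0 //.
exact: leq_add.
Qed.

Lemma nil_word_nil : nil_word O [::] = 1 :> N.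
Proof. exact: big_nil. Qed.

Lemma coef_word1 c : coef 1%g (nil_word O c) = (c == [::])%:R.
Proof.
rewrite coef_word len1 size_eq0; case: eqP => // ->.
by rewrite wprod_nil eqxx.
Qed.

Lemma coef1_monoid_morphism : GRing.monoid_morphism (coef 1%g).
Proof.
split; first by rewrite -nil_word_nil coef_word1.
apply: (multiplicative_ext (phi := coef 1%g) (@nil_word_ind O W S)
  (@mulrA O) (@mulrCA O)).
  by move=> a x; rewrite /= linearZ.
move=> c d; rewrite /= -nil_word_cat !coef_word1 -natrM mulnb.
by congr (nat_of_bool _)%:R; case: c.
Qed.

HB.instance Definition _ := GRing.isMonoidMorphism.Build N O (coef 1%g)
  coef1_monoid_morphism.

Lemma deg_ge1 f : deg_ge 1 f <-> coef 1%g f = 0.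
Proof.
split=> [/(_ 1%g)|f1 w]; first by rewrite len1 => ->.
by rewrite ltnS leqn0 len_eq0 => /eqP->.
Qed.

Lemma deg_geD n f g : deg_ge n f -> deg_ge n g -> deg_ge n (f + g).
Proof. by move=> fn gn w wn; rewrite raddfD /= fn // gn // addr0. Qed.

Lemma deg_ge_sum n (T : eqType) (s : seq T) (F : T -> N) :
  (forall t, t \in s -> deg_ge n (F t)) -> deg_ge n (\sum_(t <- s) F t).
Proof.
move=> Fn; rewrite big_seq; apply: big_ind => //; last exact: deg_geD.
by move=> w _; rewrite raddf0.
Qed.

Lemma deg_ge0 n f : (forall w, (len w < n)%N) -> deg_ge n f -> f = 0.
Proof.
by move=> wn fn; rewrite (nil_coefE WS f) big1 // => w _; rewrite fn ?scale0r.
Qed.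

Lemma len_bound : exists n, (2 <= n)%N /\ forall w, (len w < n)%N.
Proof.
(* Two successors give a strict bound that is at least 2 even when W is trivial. *)
exists (\max_w len w).+2; split=> // w.
by rewrite ltnS ltnW // ltnS (leq_bigmax w).
Qed.

(** The map [phi] allows two uses: the identity, for powers of ideals of N, and the evaluation of
    paths, for powers of the arrow ideal. *)
Lemma ideal_exp_deg (A : pzRingType) (phi : {additive A -> N}) (I : ideal A) n :
  {morph phi : x y / x * y} ->
  (forall x, ideal_set I x -> deg_ge 1 (phi x)) ->
  forall x, ideal_set (ideal_exp I n) x -> deg_ge n (phi x).
Proof.
move=> phiM phi1.
elim: n => [|n IHn] x; first by [].
move=> [s [sI ->]]; rewrite raddf_sum; apply: deg_ge_sum => u /sI[Iu1 Iu2].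
by rewrite /= phiM -add1n; apply: deg_geM; [apply: phi1 | apply: IHn].
Qed.

Section AugmentationPowers.
Variable J : ideal N.
Hypothesis JE : forall x, ideal_set J x <-> coef 1%g x = 0.

Lemma nil_word_ideal n (c : word) :
  (n <= size c)%N -> ideal_set (ideal_exp J n) (nil_word O c).
Proof.
elim: n c => [//|n IHn] [//|s c] nc.
rewrite /nil_word big_cons; apply: ideal_mul_mem; last exact: IHn.
by apply/JE; have := coef_word1 [:: s]; rewrite /nil_word big_seq1.
Qed.

Lemma augmentation_exp n x : ideal_set (ideal_exp J n) x <-> deg_ge n x.
Proof.
split.
  by apply: (@ideal_exp_deg _ idfun) => // y /JE/deg_ge1.
move=> xn; rewrite (nil_coefE WS x); apply: ideal_sum => w _.
have [wn|nw] := ltnP (len w) n.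
  by rewrite xn // scale0r; have [[]] := idealP (ideal_exp J n).
apply: idealZ; have [c sz_c ->] := nil_basis_word w.
by apply: nil_word_ideal; rewrite sz_c.
Qed.

(** The classes of the T_w with l(w) < n form a basis, since modulo J^n an element is determined by
    its coefficients at these w. *)
Lemma augmentation_exp_free n : is_free (quotient_alg (ideal_exp J n)).
Proof.
pose pr : N -> _ := proj_quot (ideal_exp J n).
have prE u v : pr u = pr v <-> deg_ge n (u - v).
  by rewrite -augmentation_exp; apply: proj_quot_eq.
pose I : eqType := {w : W | (len w < n)%N}.
have coefI (s : seq I) (c : I -> O) (i : I) : uniq s ->
    coef (val i) (\sum_(j <- s) c j *: nil_basis O WS (val j)) =
    if i \in s then c i else 0.
  move=> us; rewrite raddf_sum /=.
  under eq_bigr do rewrite linearZ /= coef_basis (inj_eq val_inj).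
  have [si|nsi] := boolP (i \in s).
    rewrite (bigD1_seq i) //= eqxx mulr1 big1 ?addr0 // => j /negbTE ->.
    exact: mulr0.
  rewrite big1_seq // => j /= js; case: eqP js nsi => [-> ->//|_ _ _].
  exact: mulr0.
have prS (s : seq I) (c : I -> O) :
    \sum_(j <- s) c j *: pr (nil_basis O WS (val j)) =
    pr (\sum_(j <- s) c j *: nil_basis O WS (val j)).
  by rewrite /pr raddf_sum; apply: eq_bigr => j _; rewrite /= linearZ.
exists I, (fun i => pr (nil_basis O WS (val i))); split=> [s c us|v].
  have pr0 : pr 0 = 0 by exact: raddf0.
  rewrite prS -pr0 => /prE; rewrite subr0 => s0 i si.
  by have := s0 (val i) (valP i); rewrite coefI // si.
exists (index_enum _), (fun i => coef (val i) (repr_quot v)).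
rewrite prS -[LHS]repr_quotK; apply/prE => w wn.
rewrite raddfB /=; apply/eqP; rewrite subr_eq0.
by rewrite (coefI _ _ (Sub w wn)) ?index_enum_uniq // mem_index_enum.
Qed.

End AugmentationPowers.

Lemma nil_free_of_finite_rank : exists b : 'I_#|W| -> N, is_basis b.
Proof.
exists (fun i => nil_basis O WS (enum_val i)); split=> [s c us s0 i si|v].
  have := congr1 (coef (enum_val i)) s0.
  rewrite raddf0 raddf_sum /=.
  under eq_bigr do rewrite linearZ /= coef_basis (inj_eq enum_val_inj).
  rewrite (bigD1_seq i) //= eqxx mulr1 big1 ?addr0 // => j /negbTE ->.
  exact: mulr0.
exists (index_enum _), (fun i => coef (enum_val i) v).
by rewrite {1}(nil_coefE WS v) (reindex _ (onW_bij _ (@enum_val_bij W))).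
Qed.

End Degree.

(** * Paths on one vertex and their evaluation *)

Section Quiver.
Variables (O : idomainType) (W : finGroupType) (S : {set W}).
Hypothesis WS : is_coxeter_system S.
Local Notation N := (nilcoxeter O S).
Local Notation word := (seq (simple S)).
Local Notation coef := (@coef O W S WS).
Local Notation len := (@len W S WS).

Definition rose : quiver :=
  @Quiver unit (simple S) (fun=> tt) (fun=> tt).

Local Notation P := (path_alg O rose).

Lemma rose_is_path (c : word) : @is_path_from rose tt c.
Proof. by elim: c. Qed.

Definition rose_path (c : word) : qpath rose :=
  @QPath rose (tt, c) (rose_is_path c).

Lemma rose_pathK (p : qpath rose) : rose_path (path_arrows p) = p.
Proof. by apply: path_eq => //=; case: (path_source p). Qed.

Lemma rose_path_cat c d :
  path_cat (rose_path c) (rose_path d) = Some (rose_path (c ++ d)).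
Proof.
have [|r -> [rs ra]] := @path_catP rose (rose_path c) (rose_path d).
  by case: (path_target (rose_path c) : unit).
by congr Some; apply: path_eq.
Qed.

Definition rose_eval : P -> N :=
  malg_lin (fun p : qpath rose => nil_word O (path_arrows p)).

Lemma rose_eval_is_linear : linear rose_eval.
Proof. exact: malg_lin_is_linear. Qed.

HB.instance Definition _ :=
  GRing.isLinear.Build O P N *:%R rose_eval rose_eval_is_linear.

Lemma rose_eval_path c : rose_eval (path_basis O (rose_path c)) = nil_word O c.
Proof. exact: malg_linU. Qed.

Lemma rose_path_ind (Q : P -> Prop) :
  Q 0 -> (forall f g, Q f -> Q g -> Q (f + g)) ->
  (forall a c, Q (a *: path_basis O (rose_path c))) -> forall f, Q f.
Proof.
move=> Q0 QD QZ; apply: path_basis_ind => // a p; rewrite -(rose_pathK p).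
exact: QZ.
Qed.

Lemma rose_path_mul c d :
  path_basis O (rose_path c) * path_basis O (rose_path d) =
  path_basis O (rose_path (c ++ d)).
Proof.
by rewrite [LHS]path_mulE /path_mul_basis rose_path_cat.
Qed.

Lemma rose_eval_monoid_morphism : GRing.monoid_morphism rose_eval.
Proof.
split.
  rewrite [1]/(path_one O rose) /path_one (bigD1 tt) //= big1; last by case.
  rewrite addr0 -[RHS]nil_word_nil -rose_eval_path.
  by congr (rose_eval (path_basis O _)); apply: path_eq.
apply: (multiplicative_ext (phi := rose_eval) rose_path_ind
  (@pzalg_scalerAl O N) (@pzalg_scalerAr O N)) => [a x|c d].
  exact: linearZ.
rewrite rose_path_mul [LHS]rose_eval_path nil_word_cat.
by rewrite -(rose_eval_path c) -(rose_eval_path d).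
Qed.

HB.instance Definition _ := GRing.isMonoidMorphism.Build P N rose_eval
  rose_eval_monoid_morphism.

Lemma rose_eval_surj y : exists x, rose_eval x = y.
Proof.
elim/nil_word_ind: y => [|f g [u <-] [v <-]|a c].
- by exists 0; rewrite raddf0.
- by exists (u + v); rewrite raddfD.
by exists (a *: path_basis O (rose_path c)); rewrite linearZ /= rose_eval_path.
Qed.

Lemma coef_rose_eval w f : coef w (rose_eval f) =
  \sum_(p <- msupp f)
    f@_p * ((path_length p == len w) && (wprod (path_arrows p) == w))%:R.
Proof.
rewrite raddf_sum; apply: eq_bigr => p _ /=.
by rewrite linearZ /= coef_word.
Qed.

Lemma rose_eval_arrow_ideal f : ideal_set (arrow_ideal O rose) f ->
  deg_ge WS 1 (rose_eval f).
Proof.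
move=> Jf w; rewrite ltnS leqn0 => /eqP w0; rewrite coef_rose_eval.
rewrite big1_seq // => p /andP[_ /Jf]; rewrite lt0n -w0 => /negbTE ->.
exact: mulr0.
Qed.

(** A word with at most one letter is the only reduced word of its product, so no other path
    contributes to this coefficient. *)
Lemma rose_eval_short f (p : qpath rose) : (path_length p < 2)%N ->
  coef (wprod (path_arrows p)) (rose_eval f) = f@_p.
Proof.
move=> p2; set w := wprod _.
have lw : len w = path_length p.
  rewrite /w; case: (p) p2 => -[v [|s [|t c]]] //= i _.
    by rewrite [path_arrows _]/= wprod_nil len1.
  by rewrite [path_arrows _]/= wprod_cons wprod_nil mulg1 len_simple.
have uniq_p (q : qpath rose) :
    path_length q = len w -> wprod (path_arrows q) = w -> q = p.
  rewrite /w lw => qp; rewrite -(rose_pathK p) -(rose_pathK q) => qw.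
  congr rose_path.
  move: p2 qp qw; rewrite /path_length !rose_pathK.
  case: (path_arrows p) => [|s [|t c]] // _; first by move/size0nil.
  case: (path_arrows q) => [|s' [|t' c']] // _.
  by rewrite !wprod_cons wprod_nil !mulg1 => /val_inj ->.
rewrite coef_rose_eval; have [pf|pf] := boolP (p \in msupp f).
  rewrite (bigD1_seq p) ?fset_uniq //= lw !eqxx mulr1 big1 ?addr0 // => q /eqP nqp.
  case: eqP => [ql|_]; last exact: mulr0.
  case: eqP => [qw|_]; last exact: mulr0.
  by case: nqp; apply: uniq_p; rewrite ?lw.
rewrite (mcoeff_outdom pf) big1_seq // => q /andP[_ qf].
case: eqP => [ql|_]; last exact: mulr0.
case: eqP => [qw|_]; last exact: mulr0.
by move: pf; rewrite -(uniq_p q ql qw) qf.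
Qed.

(** By [rose_eval_short], the support of an element of the kernel contains no path of length below
    2. *)
Lemma rose_eval_kernel_sub f : rose_eval f = 0 ->
  ideal_set (ideal_exp (arrow_ideal O rose) 2) f.
Proof.
move=> f0.
have long p : p \in msupp f -> (2 <= path_length p)%N.
  rewrite -mcoeff_neq0 leqNgt; apply: contra => /(rose_eval_short f) <-.
  by rewrite f0 raddf0.
have -> : f = \sum_(p <- msupp f) f@_p *: path_basis O p := malg_sumE f.
apply: (@ideal_sum _ (ideal_exp (arrow_ideal O rose) 2)) => p /long lp.
apply: idealZ; rewrite -(rose_pathK p).
have arrowJ s : ideal_set (arrow_ideal O rose) (path_basis O (rose_path [:: s])).
  by move=> q; rewrite msuppU oner_eq0 in_fset1 => /eqP ->.
move: lp; rewrite /path_length; case: (path_arrows p) => [|s [|t c]] // _.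
(* Two loops are split off; the rest of the path falls into the zeroth power of the arrow ideal,
   which is the whole algebra. *)
rewrite -(cat1s s) -(cat1s t) -2!rose_path_mul.
by apply: ideal_mul_mem => //; apply: ideal_mul_mem.
Qed.

End Quiver.

(** * The quiver presentation and the quotients by the powers of J *)

Theorem theorem11p2 (O : idomainType) (pi : O)
  (O_pid : is_pid O) (O_local : is_local_with (principal_ideal pi))
  (W : finGroupType) (S : {set W}) (WS : is_coxeter_system S) :
  let N := nilcoxeter O S in
  let K := {fraction O} in
  let J := ideal_preimage
             (tensor_incl (@FracField.tofrac O : {rmorphism O -> K}) (A := N))
             (jacobson (tensor_alg (@FracField.tofrac O : {rmorphism O -> K}) N)) in
  (exists (Q : quiver) (I : ideal (path_alg O Q)),
     [/\ exists n : nat, [/\ (2 <= n)%N,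
           ideal_exp (arrow_ideal O Q) n `<=` I &
           I `<=` ideal_exp (arrow_ideal O Q) 2],
         algebra_isomorphic N (quotient_alg I) &
         is_free_of_finite_rank (quotient_alg I)]) /\
  (forall n : nat, (1 <= n)%N -> is_free (quotient_alg (ideal_exp J n))).
Proof.
move=> N K J; have [b [b2 bound]] := len_bound WS; split.
  pose I := kernel (rose_eval (O := O) (S := S)).
  have iso : algebra_isomorphic N (quotient_alg I).
    apply: (first_isomorphism (rose_eval_monoid_morphism O S)) => //.
    exact: rose_eval_surj.
  exists (rose S), I; split=> //.
    exists b; split=> // [f Jf|f]; last exact: rose_eval_kernel_sub.
    (* Elements of the b-th power evaluate to degree at least b, beyond every length, hence to 0. *)
    apply: (deg_ge0 bound (f := rose_eval f)).
    apply: (ideal_exp_deg _ _ Jf) => [x y|x]; first exact: rmorphM.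
    exact: rose_eval_arrow_ideal.
  have [g [gL _ gbij]] := iso; have [c cB] := nil_free_of_finite_rank O WS.
  pose gA := GRing.isLinear.Build O N (quotient_alg I) *:%R g gL.
  pose G : {linear N -> quotient_alg I} := HB.pack g gA.
  by exists #|W|, (G \o c); apply: basis_image.
move=> n _.
(* The coefficient of T_1 is an augmentation whose kernel has vanishing b-th power; as O embeds in
   its fraction field, that kernel is J. *)
suff JE x : ideal_set J x <-> coef WS 1%g x = 0.
  exact: (@augmentation_exp_free O W S WS J JE n).
have tofrac_inj : injective (@FracField.tofrac O).
  by move=> u v /eqP; rewrite tofrac_eq => /eqP.
have coefZ : scalable_for *%R (coef (O := O) WS 1%g).
  by move=> a u; rewrite linearZ.
have nil : exists m, ideal_exp (kernel (coef (O := O) WS 1%g)) m `<=` [set 0].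
  exists b => u /= ub; apply: (deg_ge0 bound).
  by apply: (@ideal_exp_deg O W S WS _ idfun _ b _ _ u ub) => // y /deg_ge1.
have JK : ideal_set J = kernel (coef (O := O) WS 1%g) :=
  tensor_jacobson_preimage tofrac_inj coefZ nil.
by rewrite JK.
Qed.
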